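(* For a real number $k$ let $$Q_k(x,y)=y^2+(x^4+kx^3+2kx^2+kx+1)y+x^4,$$ $$P_k(x,y)=(x+1)(y+1)(x+y)-kxy,$$ $$R_k(x,y)=x+\frac1x+y+\frac1y+(k-4).$$ Then $$m(Q_k(x-1,y))=\begin{cases} m(R_k), & k\leqslant -1,\\[2pt] \frac12\left(m(P_k)+m(R_k)\right), & k\geqslant 17.\end{cases}$$
   Context: For a non-zero rational function $P\in\mathbb{C}(x_1,\dots,x_n)$, the (logarithmic) Mahler measure is $$m(P)=\frac{1}{(2\pi i)^n}\int_{\mathbb{T}^n}\log|P(x_1,\dots,x_n)|\,\frac{dx_1}{x_1}\cdots\frac{dx_n}{x_n},$$ where $\mathbb{T}^n=\{(x_1,\dots,x_n)\in\mathbb{C}^n:|x_1|=\cdots=|x_n|=1\}$. Here $Q_k(x-1,y)$ denotes the polynomial in $x,y$ obtained from $Q_k(x,y)$ by substituting $x-1$ for $x$. *)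

(* Defs.v *)
From HB Require Import structures.
From mathcomp Require Import all_boot all_order all_algebra.
From mathcomp Require Import complex.
From mathcomp Require Import all_classical all_reals all_analysis.

Set Implicit Arguments.
Unset Strict Implicit.
Unset Printing Implicit Defensive.

Import Order.TTheory GRing.Theory Num.Theory.
Import numFieldNormedType.Exports.

Local Open Scope classical_set_scope.
Local Open Scope complex_scope.
Local Open Scope ring_scope.

(* The polynomial ring C[x, y] is {poly {poly R[i]}} with the conventions of
   polyXY: x is 'X, the outer variable, y is 'Y = 'X%:P, the inner one, and
   p.[x, y] is evaluation. Its field of fractions is C(x, y). *)
Notation bipoly R := {poly {poly R[i]}}.
Notation "p %:F" := (@FracField.tofrac _ p) : ring_scope.
Notation birat R := {fraction {poly {poly R[i]}}}.

Section Mahler.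
Context {R : realType}.

Definition cis (t : R) : R[i] := cos t +i* sin t.

(* The value of f at (a, b) is computed from the representative of f chosen by
   the quotient {fraction _}. Another representative can only give another
   value where one of the two denominators vanishes, and the points of the
   torus where this happens form a set of measure zero. *)
Definition birat_eval (f : birat R) (a b : R[i]) : R[i] :=
  (repr f).1.[a, b] / (repr f).2.[a, b].

(* With x = e^(i s) and y = e^(i t) one has dx / (i x) = ds and
   dy / (i y) = dt, so the integral over the torus in the definition of m is
   an integral over [0, 2 pi]^2. The convention ln 0 = 0 only matters on
   the zeros and poles of f, a set of measure zero when f != 0. *)
Definition mahler (f : birat R) : R :=
  ((2 * pi) ^+ 2)^-1 *
  \int[(lebesgue_measure \x lebesgue_measure)%E]_(z in
      `[0, 2 * pi] `*` `[0, 2 * pi])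
    ln (complex.Re `|birat_eval f (cis z.1) (cis z.2)|).

Definition Q_ (k : R) : bipoly R :=
  let k := (k%:C)%:P%:P in
  'Y ^+ 2 + ('X ^+ 4 + k * 'X ^+ 3 + 2 * k * 'X ^+ 2 + k * 'X + 1) * 'Y
  + 'X ^+ 4.

Definition P_ (k : R) : bipoly R :=
  ('X + 1) * ('Y + 1) * ('X + 'Y) - (k%:C)%:P%:P * 'X * 'Y.

Definition R_ (k : R) : birat R :=
  let x := 'X%:F in
  let y := 'Y%:F in
  x + x^-1 + y + y^-1 + (((k - 4)%:C)%:P%:P)%:F.

End Mahler.

(* Main.v *)
Require Import Defs.
From mathcomp Require Import all_boot all_order all_algebra.
From mathcomp Require Import complex.
From mathcomp Require Import all_classical all_reals all_analysis.
From mathcomp Require Import measurable_realfun ring lra.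

(** Write x = e^(i s) and y = e^(i t). For fixed x, Jensen's formula in y, in
    the form m(c (y - a) (y - b)) = ln |c| + ln max(1, |a|) + ln max(1, |b|),
    allows the substitution y = (x - 1)^2 z in Q_k(x - 1, y), because there is
    no root between the circles |y| = 1 and |y| = |x - 1|^2. For fixed z the
    result factors as a product of two terms x^2 - s x + s, where s runs over
    the real roots of s^2 - (4 - k) s + (2 + 2 cos t), and Jensen's formula in x
    evaluates the inner mean in terms of the absolute value T of the larger
    root. For k <= -1 it is ln T, which is also the inner mean of R_k after the
    substitution y = x / z. For k >= 17 it is ln T / 2 + J / 2 for an explicit
    J. A Landen transformation shows that J and the inner mean of P_k have
    means whose derivatives in k agree, and the two means are compared by
    letting k go to infinity. *)

Set Implicit Arguments.
Unset Strict Implicit.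
Unset Printing Implicit Defensive.

Import Order.TTheory GRing.Theory Num.Theory.
Import numFieldNormedType.Exports.

Local Open Scope classical_set_scope.
Local Open Scope ring_scope.

(** * Mean values over the circle *)

(** The thresholds have different origins. The separation of the circles [|y| = 1] and
    [|y| = |x - 1|^2] holds for [k <= 0] and for [17 <= k]; at [k = 17] the criterion becomes an
    equality at [x = -1]. The bound [-1] comes from the real roots [s]: for [k = -1] and [cos t = 1]
    they are exactly [1] and [4], the ends of the ranges where [x^2 - s x + s] has mean [0] and
    [ln s]. The Landen comparison asks for [8 < k]. The integrands are unbounded below and follow
    the convention [ln 0 = 0]. Limits and exchanges of integrals therefore pass through the
    nonnegative function [C - f], where monotone convergence and Tonelli apply. Torus means and
    iterated means are shown equivalent, integrability included, so that a value can pass between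
    two polynomials that agree only after the inner integration. The Landen substitution does not
    match the logarithms [J] and the inner mean of [P_k] themselves. It matches their derivatives in
    [k], which are algebraic integrands of elliptic type. *)

Section Means.
Context {R : realType}.
Local Notation mu := (@lebesgue_measure R).
Local Notation I := (`[0, 2 * pi]%classic : set R).

(** Integrability is part of the notion: the real-valued integral is a default value when it fails,
    so the equation alone would carry no information. *)
Definition circle_mean (f : R -> R) (v : R) :=
  mu.-integrable I (EFin \o f) /\ \int[mu]_(t in I) f t = 2 * pi * v.

Lemma two_pi_gt0 : 0 < 2 * pi :> R.
Proof. by rewrite mulr_gt0// pi_gt0. Qed.

Lemma circle_measure : mu I = (2 * pi)%:E.
Proof. by rewrite lebesgue_measure_itv/= lte_fin two_pi_gt0 sube0. Qed.

Lemma circle_mean_uniq f v w : circle_mean f v -> circle_mean f w -> v = w.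
Proof.
by move=> [_ fv] [_]; rewrite fv => /mulfI; apply; rewrite gt_eqF// two_pi_gt0.
Qed.

Lemma circle_mean_eq f g v : (forall t, I t -> f t = g t) ->
  circle_mean f v -> circle_mean g v.
Proof.
move=> fg [fi fv]; split; last first.
  by rewrite -fv; apply: eq_Rintegral => t /set_mem /fg.
by apply: eq_integrable fi => // t /set_mem /fg /= ->.
Qed.

Lemma circle_meanD f g v w : circle_mean f v -> circle_mean g w ->
  circle_mean (fun t => f t + g t) (v + w).
Proof.
move=> [fi fv] [gi gw]; split.
  have -> : EFin \o (fun t => f t + g t) = ((EFin \o f) \+ (EFin \o g))%E.
    by apply/funext => t /=; rewrite EFinD.
  exact: integrableD.
by rewrite RintegralD// fv gw -mulrDr.
Qed.

Lemma circle_meanZ (a : R) f v : circle_mean f v ->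
  circle_mean (fun t => a * f t) (a * v).
Proof.
move=> [fi fv]; split.
  have -> : EFin \o (fun t => a * f t) = (fun t => a%:E * (EFin \o f) t)%E.
    by apply/funext => t /=; rewrite EFinM.
  exact: integrableZl.
by rewrite RintegralZl// fv mulrCA.
Qed.

Lemma circle_mean_cst (a : R) : circle_mean (cst a) a.
Proof.
split; last first.
  by rewrite Rintegral_cst//= circle_measure/= mulrC.
apply: continuous_compact_integrable; first exact: segment_compact.
by apply: continuous_subspaceT => t; exact: cvg_cst.
Qed.

Lemma circle_mean_continuous f : continuous f ->
  circle_mean f ((2 * pi)^-1 * \int[mu]_(t in I) f t).
Proof.
move=> cf; split.
  apply: continuous_compact_integrable; first exact: segment_compact.
  exact: continuous_subspaceT.
by rewrite mulrA divff ?mul1r// gt_eqF// two_pi_gt0.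
Qed.

(** Serves to split the logarithm of a product, which fails at the zeros of the factors because
    [ln 0 = 0]. *)
Lemma circle_mean_ae (f g : R -> R) v (Z : set R) : countable Z ->
  measurable_fun setT g ->
  (forall t, I t -> ~ Z t -> f t = g t) ->
  circle_mean f v -> circle_mean g v.
Proof.
move=> cZ mg fg [fi fv].
have mZ : measurable Z by exact: countable_measurable.
have Z0 : mu Z = 0%E by exact: countable_lebesgue_measure0.
have mge := (measurable_EFinP I g).2 (measurable_funTS mg).
have E : {in I `\` Z, (EFin \o f : R -> \bar R) =1 EFin \o g}.
  by move=> t /set_mem [It Zt] /=; rewrite fg.
have gi : mu.-integrable I (EFin \o g).
  apply: (iffRL (@negligible_integrable _ _ _ mu _ _ _ mZ (measurable_itv _) mge Z0)).
  apply: (@eq_integrable _ _ _ mu (I `\` Z) (measurableD (measurable_itv _) mZ)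
    (EFin \o f) _ E).
  exact: (iffLR (@negligible_integrable _ _ _ mu _ _ _ mZ (measurable_itv _)
    (measurable_int mu fi) Z0)).
split => //; rewrite -fv /Rintegral.
rewrite (@negligible_integral _ _ _ mu _ _ _ mZ (measurable_itv _) gi Z0).
rewrite [in RHS](@negligible_integral _ _ _ mu _ _ _ mZ (measurable_itv _) fi Z0).
by congr fine; apply: eq_integral => t tI; rewrite E.
Qed.

End Means.

(** * Primitives and the fundamental theorem of calculus *)

Section Primitives.
Context {R : realType}.
Local Notation mu := (@lebesgue_measure R).

Lemma continuous_integrable (f : R -> R) c d : continuous f ->
  mu.-integrable `[c, d] (EFin \o f).
Proof.
move=> cf; apply: continuous_compact_integrable; first exact: segment_compact.
exact: continuous_subspaceT.
Qed.

Lemma is_derive_cvg (F : R -> R) (x df : R) : is_derive x 1 F df ->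
  F @ x --> F x.
Proof.
by move=> [/derivable1_diffP dF _]; exact: (@differentiable_continuous _ _ _ x F dF).
Qed.

(** Differentiability is asked only inside the interval because the Landen substitution goes through
    [asin], which has no derivative at [-1] and [1]. *)
Lemma derive_integral (f F : R -> R) (c d : R) : c <= d -> {within `[c, d], continuous f} ->
  (forall x, c < x < d -> is_derive x 1 F (f x)) ->
  {within `[c, d], continuous F} ->
  \int[mu]_(t in `[c, d]) f t = F d - F c.
Proof.
rewrite le_eqVlt => /predU1P[<- _ _ _|cd cf dF cF].
  by rewrite set_itv1 Rintegral_set1 subrr.
have /(continuous_within_itvP _ cd) [cFo cFc cFd] := cF.
rewrite /Rintegral (@continuous_FTC2 _ f F)//.
- split=> // x; rewrite in_itv/= => xcd.
  by have [] := dF _ xcd.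
- move=> x; rewrite in_itv/= => xcd; rewrite derive1E.
  by have [_ ->] := dF _ xcd.
Qed.

Lemma is_derive_within (f F : R -> R) (c d : R) :
  (forall x, c <= x <= d -> is_derive x 1 F (f x)) ->
  {within `[c, d], continuous F}.
Proof.
move=> dF; apply: derivable_within_continuous => x; rewrite in_itv/= => xcd.
by have [] := dF _ xcd.
Qed.

Lemma derive_integral_continuous (f F : R -> R) (c d : R) : c <= d -> continuous f ->
  (forall x, c <= x <= d -> is_derive x 1 F (f x)) ->
  \int[mu]_(t in `[c, d]) f t = F d - F c.
Proof.
move=> cd cf dF; apply: derive_integral => //.
- exact: continuous_subspaceT.
- by move=> x /andP[/ltW cx /ltW xd]; apply: dF; rewrite cx.
- exact: is_derive_within dF.
Qed.

(** The base point [a] is placed to the left of the interval of interest, so that the derivative is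
    two-sided at its end points too. *)
Lemma primitive_exists (f : R -> R) (a : R) : continuous f ->
  exists F : R -> R, forall x, a < x -> is_derive x 1 F (f x).
Proof.
move=> cf; exists (fun x => \int[mu]_(t in `[a, x]) f t) => x ax.
have xu : x < x + 1 by rewrite ltrDl.
have [] := @continuous_FTC1_closed _ f a x (x + 1) xu
  (continuous_integrable _ _ cf) ax (cf x).
move=> dF F'; apply: DeriveDef => //.
by rewrite -derive1E.
Qed.

Lemma derive0_eq (g : R -> R) (c d : R) : c <= d ->
  (forall x, c <= x <= d -> is_derive x 1 g 0) -> g c = g d.
Proof.
move=> cd dg; have := @derive_integral_continuous (cst 0) g c d cd _ dg.
rewrite Rintegral_cst// mul0r => /(_ (fun=> cvg_cst _))/esym/eqP.
by rewrite subr_eq0 => /eqP.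
Qed.

End Primitives.

(** * Shift, reflection and doubling for periodic functions *)

Section Periodic.
Context {R : realType}.

Lemma is_derive_affine (a b x : R) : is_derive x 1 (fun t : R => a * t + b) a.
Proof.
have -> : (fun t : R => a * t + b) = a *: id + cst b.
  by apply/funext => t.
by apply: is_derive_eq; rewrite addr0; exact: mulr1.
Qed.

Variable f : R -> R.
Hypothesis cf : continuous f.
Hypothesis pf : forall t, f (t + 2 * pi) = f t.

Let continuous_affine (a b : R) : continuous (fun t => f (a * t + b)).
Proof.
move=> x; apply: (@continuous_comp _ _ _ (fun t => a * t + b) f).
  exact: is_derive_cvg (is_derive_affine a b x).
exact: cf.
Qed.

(** The increment of [F] over one period has derivative [f (x + 2 pi) - f x = 0], hence is constant,
    and at [x = 0] it is the integral over the circle. *)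
Let periodic_primitive (a v : R) : a < 0 -> circle_mean f v ->
  exists2 F : R -> R, forall x, a < x -> is_derive x 1 F (f x) &
    forall x, a < x -> F (x + 2 * pi) - F x = 2 * pi * v.
Proof.
move=> a0 [_ fv].
have p0 := @two_pi_gt0 R.
have [F dF] := primitive_exists a cf.
exists F => // x ax; rewrite -fv.
have dFI y : 0 <= y <= 2 * pi -> is_derive y 1 F (f y).
  by move=> /andP[y0 _]; apply: dF; exact: lt_le_trans y0.
rewrite (derive_integral_continuous (ltW p0) cf dFI).
pose g y := F (y + 2 * pi) - F y.
have dg y : a < y -> is_derive y 1 g 0.
  move=> ay.
  have h1 : is_derive (1 * y + 2 * pi) 1 F (f (1 * y + 2 * pi)).
    by apply: dF; rewrite mul1r (lt_le_trans ay)// lerDl ltW.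
  have h2 := dF _ ay.
  have h3 := is_derive_affine 1 (2 * pi) y.
  have -> : g = (F \o (fun t => 1 * t + 2 * pi)) - F.
    by apply/funext => t; rewrite -[RHS]/(F (1 * t + 2 * pi) - F t) mul1r.
  have h4 := @is_derive1_comp _ F (fun t => 1 * t + 2 * pi) y _ _ h1 h3.
  have h5 := is_deriveB h4 h2.
  by apply: (is_derive_eq h5); rewrite mul1r pf mulr1 subrr.
rewrite -/(g x) -[F (2 * pi)]add0r.
have -> : F (2 * pi) = F (0 + 2 * pi) by rewrite add0r.
rewrite add0r -/(g 0).
have [x0|/ltW x0] := leP x 0.
  by apply: derive0_eq x0 _ => y /andP[xy _]; apply: dg; exact: lt_le_trans xy.
apply/esym/(derive0_eq x0) => y /andP[xy _]; apply: dg; exact: lt_le_trans xy.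
Qed.

(** Change of variable through the primitive [a^-1 * F (a * t + b)]: only the increment of [F] over
    the image interval has to be known. *)
Let affine_mean (a b w c : R) (F : R -> R) : a != 0 ->
  (forall x, c < x -> is_derive x 1 F (f x)) ->
  (forall x, 0 <= x <= 2 * pi -> c < a * x + b) ->
  F (a * (2 * pi) + b) - F b = a * (2 * pi * w) ->
  circle_mean (fun t => f (a * t + b)) w.
Proof.
move=> a0 dF cx Fw; split; first exact: continuous_integrable.
have dG x : 0 <= x <= 2 * pi -> is_derive x 1 (fun t => a^-1 * F (a * t + b))
    (f (a * x + b)).
  move=> /cx xp; have h1 := dF _ xp; have h2 := is_derive_affine a b x.
  have -> : (fun t => a^-1 * F (a * t + b)) = a^-1 *: (F \o (fun t => a * t + b)).
    by apply/funext.
  have h3 := @is_derive1_comp _ F (fun t => a * t + b) x _ _ h1 h2.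
  have h4 := @is_deriveZ _ _ _ _ a^-1 x 1 _ h3.
  by apply: (is_derive_eq h4); rewrite -[_ *: _]/(_ * _) mulrCA mulVf// mulr1.
rewrite (derive_integral_continuous (ltW two_pi_gt0) (@continuous_affine a b) dG).
by rewrite mulr0 add0r -mulrBr Fw mulKf.
Qed.

Lemma circle_mean_shift (b v : R) : circle_mean f v ->
  circle_mean (fun t => f (t + b)) v.
Proof.
(* This base point lies to the left of [0] and of every [t + b] with [0 <= t]. *)
move=> fv; have a0 : - `|b| - 1 < 0 :> R by have := normr_ge0 b; lra.
have [F dF FE] := periodic_primitive a0 fv.
have : circle_mean (fun t => f (1 * t + b)) v.
  apply: (affine_mean _ dF) => //.
    move=> x /andP[x0 _]; have := ler_norm (- b); rewrite normrN; lra.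
  rewrite !mul1r [2 * pi + b]addrC FE//; have := ler_norm (- b); rewrite normrN; lra.
by apply: circle_mean_eq => t _; rewrite mul1r.
Qed.

Lemma circle_mean_reflect (b v : R) : circle_mean f v ->
  circle_mean (fun t => f (b - t)) v.
Proof.
move=> fv; have p0 := @two_pi_gt0 R.
have a0 : - `|b| - 2 * pi - 1 < 0 :> R by have := normr_ge0 b; lra.
have [F dF FE] := periodic_primitive a0 fv.
have nb := ler_norm (- b); rewrite normrN in nb.
have : circle_mean (fun t => f (-1 * t + b)) v.
  apply: (affine_mean _ dF) => //.
    move=> x /andP[x0 x1]; lra.
  have xE : -1 * (2 * pi) + b + 2 * pi = b by ring.
  have := FE (-1 * (2 * pi) + b); rewrite xE => FE'.
  have /FE' : - `|b| - 2 * pi - 1 < -1 * (2 * pi) + b by lra.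
  by lra.
by apply: circle_mean_eq => t _; rewrite mulN1r addrC.
Qed.

Lemma circle_mean_double (v : R) : circle_mean f v ->
  circle_mean (fun t => f (2 * t)) v.
Proof.
move=> fv; have p0 := @two_pi_gt0 R.
have [F dF FE] := periodic_primitive (@ltrN10 R) fv.
have : circle_mean (fun t => f (2 * t + 0)) v.
  apply: (affine_mean _ dF) => //.
    by move=> x /andP[x0 x1]; lra.
  rewrite addr0.
  have -> : 2 * (2 * pi) = 2 * pi + 2 * pi :> R by ring.
  have := FE 0 (@ltrN10 R); rewrite add0r => E0.
  have := FE (2 * pi) (lt_trans (@ltrN10 R) p0); lra.
by apply: circle_mean_eq => t _; rewrite addr0.
Qed.

End Periodic.

(** * Complex numbers of modulus one *)

Local Open Scope complex_scope.

Section ComplexNorm.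
Context {R : realType}.
Local Notation I := (`[0, 2 * pi]%classic : set R).
Implicit Types (z w : R[i]).

(** The modulus [|z|] itself has values in [R[i]]; this real form is the one that occurs in
    [mahler]. *)
Definition cnorm z : R := complex.Re `|z|.

Lemma cnormE z : cnorm z = Num.sqrt (complex.Re z ^+ 2 + complex.Im z ^+ 2).
Proof. by rewrite /cnorm normc_def. Qed.

Lemma normc_cnorm z : `|z| = (cnorm z)%:C.
Proof. by rewrite cnormE normc_def. Qed.

Lemma cnorm_ge0 z : 0 <= cnorm z.
Proof. by rewrite cnormE sqrtr_ge0. Qed.

Lemma cnormM z w : cnorm (z * w) = cnorm z * cnorm w.
Proof.
by apply: (@complexI R); rewrite rmorphM /= -!normc_cnorm normrM.
Qed.

Lemma cnorm_eq0 z : (cnorm z == 0) = (z == 0).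
Proof.
by rewrite -(inj_eq (@complexI R)) -normc_cnorm normr_eq0.
Qed.

Lemma cnorm_gt0 z : (0 < cnorm z) = (z != 0).
Proof. by rewrite lt_def cnorm_ge0 andbT cnorm_eq0. Qed.

Lemma cnorm_real (a : R) : cnorm a%:C = `|a|.
Proof. by rewrite cnormE /= expr0n addr0 sqrtr_sqr. Qed.

Lemma cnorm1 : cnorm 1 = 1.
Proof. by rewrite -[1](@rmorph1 _ _ (real_complex R)) cnorm_real normr1. Qed.

Lemma cnormV z : cnorm z^-1 = (cnorm z)^-1.
Proof.
by apply: (@complexI R); rewrite fmorphV /= -!normc_cnorm normfV.
Qed.

Lemma cnormN z : cnorm (- z) = cnorm z.
Proof. by rewrite /cnorm normrN. Qed.

Lemma cnormX z n : cnorm (z ^+ n) = cnorm z ^+ n.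
Proof.
by apply: (@complexI R); rewrite rmorphXn /= -!normc_cnorm normrX.
Qed.

Lemma cnormD z w : cnorm (z + w) <= cnorm z + cnorm w.
Proof.
by rewrite -lecR rmorphD /= -!normc_cnorm ler_normD.
Qed.

Lemma cnorm_ge_sub z w : cnorm z - cnorm w <= cnorm (z - w).
Proof. by rewrite lerBlDr (le_trans _ (cnormD _ _))// subrK. Qed.

Lemma cnorm_conj z : cnorm (conjc z) = cnorm z.
Proof. by rewrite /cnorm normcJ. Qed.

Lemma cnorm_sqr z : cnorm z ^+ 2 = complex.Re z ^+ 2 + complex.Im z ^+ 2.
Proof. by rewrite cnormE sqr_sqrtr// addr_ge0// sqr_ge0. Qed.

Lemma cnorm_cis (t : R) : cnorm (cis t) = 1.
Proof. by rewrite cnormE /= cos2Dsin2 sqrtr1. Qed.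

Lemma cis_neq0 (t : R) : cis t != 0.
Proof. by rewrite -cnorm_gt0 cnorm_cis ltr01. Qed.

Lemma cisD (t u : R) : cis (t + u) = cis t * cis u.
Proof.
by rewrite /cis cosD sinD; simpc; rewrite [cos t * sin u + _]addrC.
Qed.

Lemma cisN (t : R) : cis (- t) = conjc (cis t).
Proof. by rewrite /cis cosN sinN. Qed.

Lemma cis_conjV (t : R) : conjc (cis t) = (cis t)^-1.
Proof.
apply: (mulfI (cis_neq0 t)); rewrite divff ?cis_neq0//.
by rewrite -sqr_normc normc_cnorm cnorm_cis expr1n.
Qed.

Lemma cis_pi : cis pi = -1 :> R[i].
Proof. by rewrite /cis cospi sinpi; simpc. Qed.

Lemma cisD2pi (t : R) : cis (t + 2 * pi) = cis t.
Proof.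
have -> : 2 * pi = pi *+ 2 :> R by rewrite mulr_natl.
by rewrite /cis cosD2pi sinD2pi.
Qed.

Lemma cis_fiber_finite z : finite_set [set t | I t /\ cis t = z].
Proof.
apply: (@sub_finite_set _ _ [set acos (complex.Re z); 2 * pi - acos (complex.Re z)]);
  last exact: finite_set2.
move=> t /= [+ <-]; rewrite in_itv/= => /andP[t0 t2].
have [tp|/ltW tp] := leP t pi.
  by left; rewrite cosK// in_itv/= t0.
right; have -> : cos t = cos (2 * pi - t).
  by rewrite -[RHS]cosN opprB -[RHS]cosD2pi -[pi *+ 2]mulr_natl subrK.
by rewrite cosK ?subKr// in_itv/=; apply/andP; split; lra.
Qed.

(** Stated by coordinates, so that continuity of the modulus reduces to that of a real square
    root. *)
Definition complex_continuous {T : topologicalType} (f : T -> R[i]) :=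
  continuous (fun t => complex.Re (f t)) /\ continuous (fun t => complex.Im (f t)).

Lemma complex_continuous_cst (T : topologicalType) z :
  complex_continuous (fun _ : T => z).
Proof. by split => t; exact: cvg_cst. Qed.

Lemma complex_continuousD (T : topologicalType) (f g : T -> R[i]) :
  complex_continuous f -> complex_continuous g ->
  complex_continuous (fun t => f t + g t).
Proof.
move=> [f1 f2] [g1 g2]; split.
  have -> : (fun t => complex.Re (f t + g t)) =
      (fun t => complex.Re (f t)) \+ (fun t => complex.Re (g t)).
    by apply/funext => t /=; case: (f t) => ? ?; case: (g t).
  by move=> t; apply: cvgD; [exact: f1|exact: g1].
have -> : (fun t => complex.Im (f t + g t)) =
      (fun t => complex.Im (f t)) \+ (fun t => complex.Im (g t)).
  by apply/funext => t /=; case: (f t) => ? ?; case: (g t).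
by move=> t; apply: cvgD; [exact: f2|exact: g2].
Qed.

Lemma complex_continuousM (T : topologicalType) (f g : T -> R[i]) :
  complex_continuous f -> complex_continuous g ->
  complex_continuous (fun t => f t * g t).
Proof.
move=> [f1 f2] [g1 g2]; split.
  have -> : (fun t => complex.Re (f t * g t)) =
     (fun t => complex.Re (f t) * complex.Re (g t) - complex.Im (f t) * complex.Im (g t)).
    by apply/funext => t /=; case: (f t) => ? ?; case: (g t).
  move=> t; apply: cvgB; apply: cvgM.
  - exact: f1.
  - exact: g1.
  - exact: f2.
  - exact: g2.
have -> : (fun t => complex.Im (f t * g t)) =
     (fun t => complex.Re (f t) * complex.Im (g t) + complex.Im (f t) * complex.Re (g t)).
  by apply/funext => t /=; case: (f t) => ? ?; case: (g t).
move=> t; apply: cvgD; apply: cvgM.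
- exact: f1.
- exact: g2.
- exact: f2.
- exact: g1.
Qed.

Lemma complex_continuous_cis : complex_continuous (@cis R).
Proof. by split; [exact: continuous_cos|exact: continuous_sin]. Qed.

Lemma continuous_cnorm (T : topologicalType) (f : T -> R[i]) : complex_continuous f ->
  continuous (fun t => cnorm (f t)).
Proof.
move=> [f1 f2]; have -> : (fun t => cnorm (f t)) = Num.sqrt \o
   (fun t => complex.Re (f t) * complex.Re (f t) + complex.Im (f t) * complex.Im (f t)).
  by apply/funext => t; rewrite cnormE !expr2.
move=> t; apply: continuous_comp; last exact: sqrt_continuous.
by apply: cvgD; apply: cvgM; (exact: f1 || exact: f2).
Qed.

Lemma continuous_ln_cnorm (T : topologicalType) (f : T -> R[i]) : complex_continuous f ->
  (forall t, f t != 0) -> continuous (fun t => ln (cnorm (f t))).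
Proof.
move=> cf f0 t; apply: (@continuous_comp _ _ _ (fun t => cnorm (f t)) (@ln R)).
  exact: continuous_cnorm.
by apply: continuous_ln; rewrite cnorm_gt0.
Qed.

End ComplexNorm.

(** * Jensen's formula *)

Section Jensen.
Context {R : realType}.
Local Notation I := (`[0, 2 * pi]%classic : set R).
Implicit Types (a b : R[i]).

Lemma circle_mean_le (f g : R -> R) (v w : R) : circle_mean f v -> circle_mean g w ->
  (forall t, I t -> f t <= g t) -> v <= w.
Proof.
move=> [fi fv] [gi gw] fg; rewrite -(ler_pM2l (@two_pi_gt0 R)) -fv -gw.
exact: le_Rintegral.
Qed.

Let F a (t : R) := ln (cnorm (1 - a * cis t)).

Let norm_lower a (t : R) : 1 - cnorm a <= cnorm (1 - a * cis t).
Proof.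
by rewrite (le_trans _ (cnorm_ge_sub _ _))// cnorm1 cnormM cnorm_cis mulr1.
Qed.

Let norm_upper a (t : R) : cnorm a <= 1 -> cnorm (1 - a * cis t) <= 2.
Proof.
move=> a1; rewrite (le_trans (cnormD _ _))// cnormN cnorm1 cnormM cnorm_cis mulr1.
by lra.
Qed.

Let F_continuous a : cnorm a < 1 -> continuous (F a).
Proof.
move=> a1; apply: continuous_ln_cnorm.
  have -> : (fun t : R => 1 - a * cis t) = (fun t => 1 + (- a) * cis t).
    by apply/funext => t; rewrite mulNr.
  apply: complex_continuousD; first exact: complex_continuous_cst.
  apply: complex_continuousM; first exact: complex_continuous_cst.
  exact: complex_continuous_cis.
by move=> t; rewrite -cnorm_gt0 (lt_le_trans _ (norm_lower a t))// subr_gt0.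
Qed.

Let F_periodic a (t : R) : F a (t + 2 * pi) = F a t.
Proof. by rewrite /F cisD2pi. Qed.

(* [(1 - a z) (1 + a z) = 1 - a^2 z^2], and neither the rotation [z -> - z] nor
   the doubling [z -> z^2] changes the mean. *)
Let F_double a (v w : R) : cnorm a < 1 ->
  circle_mean (F a) v -> circle_mean (F (a ^+ 2)) w -> w = 2 * v.
Proof.
move=> a1 av aw; have a2 : cnorm (a ^+ 2) < 1.
  by rewrite cnormX exprn_ilt1// cnorm_ge0.
have vs := circle_mean_shift (F_continuous a1) (F_periodic a) pi av.
have wd := circle_mean_double (F_continuous a2) (F_periodic (a ^+ 2)) aw.
have vv := circle_meanD av vs.
rewrite mulr_natl mulr2n; apply: circle_mean_uniq wd _.
apply: circle_mean_eq vv => t _.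
have p u : 0 < cnorm (1 - a * cis u).
  by rewrite (lt_le_trans _ (norm_lower a u))// subr_gt0.
rewrite /F -lnM ?posrE// -cnormM; congr (ln (cnorm _)).
rewrite cisD cis_pi mulr_natl mulr2n cisD; ring.
Qed.

(** Squaring [a] doubles the mean and keeps the point in the disc of radius [cnorm a], where all
    these means are bounded by one constant. After [n] squarings the mean is [2^n v], so [v] must
    vanish. *)
Lemma jensen_disc a : cnorm a < 1 -> circle_mean (F a) 0.
Proof.
move=> a1.
(* The logarithm lies between [ln (1 - cnorm a) <= 0] and [ln 2 >= 0]; the difference of these
   bounds dominates both absolute values. *)
pose B : R := ln 2 - ln (1 - cnorm a).
have a1' : 0 < 1 - cnorm a by rewrite subr_gt0.
have l2 : 0 <= ln 2 :> R by rewrite ln_ge0// ler1n.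
have la : ln (1 - cnorm a) <= 0 by rewrite ln_le0// gerBl cnorm_ge0.
have bound b v : cnorm b <= cnorm a -> circle_mean (F b) v -> `|v| <= B.
  move=> ba bv; have b1 : cnorm b < 1 := le_lt_trans ba a1.
  have lo t : ln (1 - cnorm a) <= F b t.
    have h : 1 - cnorm a <= cnorm (1 - b * cis t).
      by rewrite (le_trans _ (norm_lower b t))// lerB.
    by rewrite /F ler_ln// posrE (lt_le_trans _ h).
  have up t : F b t <= ln 2.
    rewrite /F ler_ln// ?posrE// ?norm_upper ?ltW//.
    by rewrite (lt_le_trans _ (norm_lower b t))// subr_gt0.
  have h1 : ln (1 - cnorm a) <= v.
    exact: (circle_mean_le (circle_mean_cst _) bv (fun t _ => lo t)).
  have h2 : v <= ln 2.
    exact: (circle_mean_le bv (circle_mean_cst _) (fun t _ => up t)).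
  by rewrite /B ler_norml; apply/andP; split; lra.
have F_mean b : cnorm b < 1 -> exists v, circle_mean (F b) v.
  by move=> b1; eexists; apply: circle_mean_continuous; exact: F_continuous.
have [v av] := F_mean a a1.
suff vn n : exists2 b, cnorm b <= cnorm a & circle_mean (F b) (2 ^+ n * v).
  suff -> : 0 = v by [].
  apply/esym/eqP; rewrite -normr_le0 leNgt; apply/negP => v0.
  have [n] : exists n, (B / `|v| < n%:R).
    by exists (Num.truncn (B / `|v|)).+1; rewrite truncnS_gt.
  rewrite ltr_pdivrMr// => Bn.
  have [b ba bv] := vn n; have := bound b _ ba bv.
  rewrite leNgt => /negP; apply; apply: (lt_le_trans Bn).
  rewrite normrM ler_wpM2r// normrX normr_nat -natrX ler_nat.
  exact/ltnW/ltn_expl.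
elim: n => [|n [b ba bv]]; first by exists a => //; rewrite expr0 mul1r.
have b1 : cnorm b < 1 := le_lt_trans ba a1.
have b2 : cnorm (b ^+ 2) <= cnorm b.
  by rewrite cnormX expr2 ler_piMr ?cnorm_ge0// ltW.
have [w bw] := F_mean (b ^+ 2) (le_lt_trans b2 b1).
exists (b ^+ 2); first exact: le_trans b2 ba.
by rewrite [2 ^+ n.+1]exprS -mulrA -(F_double b1 bv bw).
Qed.

End Jensen.

(** * Monotone convergence for circle means *)

Section Monotone.
Context {R : realType}.
Local Notation mu := (@lebesgue_measure R).
Local Notation I := (`[0, 2 * pi]%classic : set R).

Lemma circle_mean_offP (f : R -> R) v (Z : set R) : countable Z ->
  measurable_fun setT f ->
  circle_mean f v <->
  mu.-integrable (I `\` Z) (EFin \o f) /\ \int[mu]_(t in I `\` Z) f t = 2 * pi * v.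
Proof.
move=> cZ mf.
have mZ : measurable Z by exact: countable_measurable.
have Z0 : mu Z = 0%E by exact: countable_lebesgue_measure0.
have mfe := (measurable_EFinP I f).2 (measurable_funTS mf).
have H := @negligible_integrable _ _ _ mu _ _ _ mZ (measurable_itv _) mfe Z0.
split => -[fi fv].
  split; first exact/H.
  by rewrite -fv /Rintegral [in RHS]
    (@negligible_integral _ _ _ mu _ _ _ mZ (measurable_itv _) fi Z0).
have fi' := H.2 fi; split => //.
rewrite -fv; congr fine.
exact: (@negligible_integral _ _ _ mu _ _ _ mZ (measurable_itv _) fi' Z0).
Qed.

(** Monotone convergence for the nonnegative functions [C - h n]; the finite limit also gives the
    integrability of [f]. The set [Z] is left out because at a logarithmic pole [h n] tends to minus
    infinity while [f] takes the value [ln 0 = 0]. *)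
Lemma circle_mean_noninc (f : R -> R) (h : nat -> R -> R) (vn : nat -> R) (v C : R)
    (Z : set R) : countable Z -> measurable_fun setT f ->
  (forall n, measurable_fun setT (h n)) ->
  (forall n, circle_mean (h n) (vn n)) ->
  (forall n t, h n t <= C) -> (forall t, f t <= C) ->
  (forall t m n, (m <= n)%N -> h n t <= h m t) ->
  (forall t, I t -> ~ Z t -> h n t @[n --> \oo] --> f t) ->
  vn n @[n --> \oo] --> v ->
  circle_mean f v.
Proof.
move=> cZ mf mh hv hC fC hdecr hf vv.
have mZ : measurable Z by exact: countable_measurable.
pose D := I `\` Z.
have mD : measurable D by exact: measurableD.
pose g n t := (C - h n t)%:E.
have Cm : circle_mean (cst C) C := circle_mean_cst C.
have gint n : (\int[mu]_(t in D) g n t = (2 * pi * (C - vn n))%:E)%E.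
  have hm : circle_mean (fun t => C + -1 * h n t) (C + -1 * vn n).
    exact: circle_meanD Cm (circle_meanZ (-1) (hv n)).
  have [|gi gv] := (circle_mean_offP _ cZ _).1 hm.
    apply: measurable_funD => //; apply: measurable_funM => //; exact: mh.
  rewrite mulN1r in gv; rewrite -gv /Rintegral fineK.
    by apply: eq_integral => t _; rewrite /g mulN1r.
  exact: integrable_fin_num.
have mono := @cvg_monotone_convergence _ _ _ mu D mD g.
have mg n : measurable_fun D (g n).
  apply/measurable_EFinP; apply: measurable_funB => //.
  exact: measurable_funTS.
have g0 n t : D t -> (0 <= g n t)%E by move=> _; rewrite lee_fin subr_ge0.
have gnd t : D t -> {homo g ^~ t : m n / (m <= n)%N >-> (m <= n)%E}.
  by move=> _ m n mn; rewrite lee_fin lerB// hdecr.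
have {mono} := mono mg g0 gnd.
under eq_fun do rewrite gint.
have -> : (\int[mu]_(t in D) limn (g ^~ t) = \int[mu]_(t in D) (C - f t)%:E)%E.
  apply: eq_integral => t /set_mem [It Zt].
  apply/cvg_lim => //; apply: cvg_EFin; first exact: nearW.
  by apply: cvgB; [exact: cvg_cst|exact: hf].
move=> cv.
have cv2 : ((2 * pi * (C - vn n))%:E @[n --> \oo] --> (2 * pi * (C - v))%:E)%E.
  apply: cvg_EFin; first exact: nearW.
  by apply: cvgM; [exact: cvg_cst|apply: cvgB => //; exact: cvg_cst].
have E := cvg_unique (@ereal_hausdorff R) cv cv2.
have mCf : measurable_fun setT (fun t => C - f t) by exact: measurable_funB.
have Cfm : circle_mean (fun t => C - f t) (C - v).
  apply/(circle_mean_offP _ cZ mCf); split.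
    apply/integrableP; split.
      by apply/measurable_EFinP; exact: measurable_funTS.
    under eq_integral => t _ do rewrite /= ger0_norm ?subr_ge0//.
    by rewrite E ltry.
  by rewrite /Rintegral E.
have := circle_meanD Cm (circle_meanZ (-1) Cfm).
have -> : C + -1 * (C - v) = v by ring.
by apply: circle_mean_eq => t _ /=; ring.
Qed.

End Monotone.

Section JensenCircle.
Context {R : realType}.
Local Notation I := (`[0, 2 * pi]%classic : set R).
Implicit Types (a b : R[i]).

Lemma measurable_ln_cnorm (f : R -> R[i]) : complex_continuous f ->
  measurable_fun setT (fun t => ln (cnorm (f t))).
Proof.
move=> cf; apply: (measurableT_comp (@measurable_ln R)).
apply: continuous_measurable_fun; exact: continuous_cnorm.
Qed.

Lemma complex_continuous_affine a b :
  complex_continuous (fun t : R => a + b * cis t).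
Proof.
apply: complex_continuousD; first exact: complex_continuous_cst.
apply: complex_continuousM; first exact: complex_continuous_cst.
exact: complex_continuous_cis.
Qed.

(* For [|a| = 1] one has [|1 - r a z|^2 / r = |1 - a z|^2 + (1 - r)^2 / r],
   which decreases to [|1 - a z|^2] as [r] increases to [1]. *)
Lemma jensen_circle a : cnorm a = 1 ->
  circle_mean (fun t => ln (cnorm (1 - a * cis t))) 0.
Proof.
move=> a1.
pose c (t : R) := cnorm (1 - a * cis t).
have cc : continuous c.
  apply: continuous_cnorm.
  have -> : (fun t : R => 1 - a * cis t) = (fun t => 1 + (- a) * cis t).
    by apply/funext => t; rewrite mulNr.
  exact: complex_continuous_affine.
have c0 t : 0 <= c t by exact: cnorm_ge0.
have c2 t : c t <= 2.
  rewrite /c (le_trans (cnormD _ _))// cnormN cnorm1 cnormM a1 cnorm_cis; lra.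
(* For these radii the excess [(1 - r)^2 / r] equals [1 / ((n + 1) (n + 2))], which is visibly
   decreasing. *)
pose r (n : nat) : R := n.+1%:R / n.+2%:R.
pose e (n : nat) : R := (n.+1%:R * n.+2%:R)^-1.
have n0 n : 0 < n.+1%:R :> R by rewrite ltr0n.
have r0 n : 0 < r n by rewrite divr_gt0.
have r1 n : r n < 1 by rewrite ltr_pdivrMr// mul1r ltr_nat.
have e0 n : 0 < e n by rewrite invr_gt0 mulr_gt0.
have e1 n : e n <= 1.
  by rewrite invf_le1 ?mulr_gt0// -natrM ler1n muln_gt0.
have cE t n : cnorm (1 - ((r n)%:C * a) * cis t) ^+ 2 = r n * (c t ^+ 2 + e n).
  have -> : e n = (1 - r n) ^+ 2 / r n.
    rewrite /e /r -!natr1; have : 0 <= n%:R :> R by [].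
    move: (n%:R : R) => N N0; field.
    by apply/andP; split; apply/eqP; lra.
  rewrite /c; move: (cnormM a (cis t)); rewrite a1 cnorm_cis mulr1 -(mulrA _ a).
  move: (a * cis t) => [u v] /(congr1 (fun x => x ^+ 2)).
  rewrite !cnorm_sqr /= expr1n => uv.
  have := r0 n; move: (r n) => rn rn0.
  apply/eqP; rewrite -subr_eq0; apply/eqP.
  transitivity ((rn ^+ 2 - rn) * (u ^+ 2 + v ^+ 2 - 1)).
    by field; rewrite gt_eqF.
  by rewrite uv; ring.
pose h n t : R := ln (c t ^+ 2 + e n) / 2.
have p n t : 0 < c t ^+ 2 + e n by rewrite ltr_wpDl// sqr_ge0.
(* The common upper bound is [ln 5 / 2], because [c t ^+ 2 <= 4] and [e n <= 1]. *)
have ln5 : 0 <= ln 5 :> R by rewrite ln_ge0// ler1n.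
have c4 t : c t ^+ 2 <= 4 by have := c2 t; have := c0 t; nra.
have fE t : ln (c t) = ln (c t ^+ 2) / 2.
  have [->|ct] := eqVneq (c t) 0; first by rewrite expr0n/= ln0// mul0r.
  have ctp : 0 < c t by rewrite lt_def ct c0.
  by rewrite lnXn// -[_ *+ 2]mulr_natr mulfK// pnatr_eq0.
have e_cvg : e n @[n --> \oo] --> 0.
  apply: (@squeeze_cvgr _ _ _ _ (fun=> 0) (@harmonic R)) => //; last 2 first.
  - exact: cvg_cst.
  - exact: cvg_harmonic.
  apply: nearW => n; rewrite ltW//= lef_pV2 ?posrE ?mulr_gt0//.
  by rewrite ler_peMr ?ler1n// ltW.
have r_cvg : r n @[n --> \oo] --> (1 : R).
  have -> : r = (fun n => 1 - harmonic (n + 1)%N).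
    apply/funext => n; rewrite /r /harmonic/= addn1 -[n.+2%:R]natr1.
    by have := n0 n; move: (n.+1%:R : R) => N N0; field; apply/eqP; lra.
  rewrite -[X in _ --> X]subr0; apply: cvgB; first exact: cvg_cst.
  by rewrite cvg_shiftn; exact: cvg_harmonic.
pose Z := [set t | I t /\ cis t = a^-1].
have a0 : a != 0 by rewrite -cnorm_gt0 a1.
apply: (@circle_mean_noninc _ _ h (fun n => - (ln (r n) / 2)) 0 (ln 5 / 2) Z).
- exact/finite_set_countable/cis_fiber_finite.
- apply: (measurableT_comp (@measurable_ln R)); exact: continuous_measurable_fun.
- move=> n; apply: measurable_funM => //.
  apply: (measurableT_comp (@measurable_ln R)).
  apply: measurable_funD => //; apply: measurable_funX.
  exact: continuous_measurable_fun.
- move=> n.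
  have ra : cnorm ((r n)%:C * a) < 1.
    by rewrite cnormM a1 mulr1 cnorm_real gtr0_norm.
  have := circle_meanD (jensen_disc ra) (circle_mean_cst (- (ln (r n) / 2))).
  rewrite add0r; apply: circle_mean_eq => t _.
  rewrite /h [cst _ _]/=.
  have -> : c t ^+ 2 + e n = cnorm (1 - ((r n)%:C * a) * cis t) ^+ 2 / r n.
    by rewrite cE mulrC mulKf// gt_eqF.
  have q : 0 < cnorm (1 - ((r n)%:C * a) * cis t).
    rewrite lt_def cnorm_ge0 andbT; apply/eqP => q.
    by have := cE t n; rewrite q expr0n/= => /esym/eqP; rewrite gt_eqF// mulr_gt0.
  by rewrite ln_div ?posrE ?exprn_gt0// lnXn// -[_ *+ 2]mulr_natr; field.
- move=> n t; rewrite ler_pM2r ?invr_gt0// ler_ln ?posrE//.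
  by have := c4 t; have := e1 n; lra.
- move=> t; rewrite fE ler_pM2r ?invr_gt0//.
  (* At a zero the default [ln 0 = 0] must respect the bound too, hence [0 <= ln 5]. *)
  have [->|ct] := eqVneq (c t) 0; first by rewrite expr0n/= ln0.
  have ctp : 0 < c t by rewrite lt_def ct c0.
  rewrite ler_ln ?posrE ?exprn_gt0//.
  by have := c4 t; lra.
- move=> t m n mn; rewrite ler_pM2r ?invr_gt0// ler_ln ?posrE// lerD2l.
  by rewrite lef_pV2 ?posrE ?mulr_gt0// -!natrM ler_nat leq_mul.
- move=> t It tZ.
  have ct : c t != 0.
    rewrite cnorm_eq0 subr_eq0 eq_sym; apply/eqP => az.
    by apply: tZ; split => //; rewrite -[RHS]mulr1 -az mulKf.
  rewrite -/(c t) fE; apply: cvgM; last exact: cvg_cst.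
  apply: continuous_cvg.
    by apply: continuous_ln; rewrite exprn_gt0// lt_def ct c0.
  rewrite -[X in _ --> X]addr0; apply: cvgD; first exact: cvg_cst.
  exact: e_cvg.
- rewrite -[X in _ --> X]oppr0; apply: cvgN.
  rewrite -[X in _ --> X](mul0r (2^-1)); apply: cvgM; last exact: cvg_cst.
  rewrite -(@ln1 R); apply: continuous_cvg.
    exact: continuous_ln.
  exact: r_cvg.
Qed.

(** On the unit circle [|z - a| = |1 - conj a z|], which has mean [0] when [|a| <= 1]. When
    [|a| > 1] the factor [a] is taken out and [a^-1] lies in the open disc. *)
Lemma jensen a :
  circle_mean (fun t => ln (cnorm (cis t - a))) (ln (Num.max 1 (cnorm a))).
Proof.
have [a1|a1] := leP (cnorm a) 1.
  rewrite ln1.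
  have : circle_mean (fun t => ln (cnorm (1 - conjc a * cis t))) 0.
    move: a1; rewrite le_eqVlt => /predU1P[a1|a1].
      by apply: jensen_circle; rewrite cnorm_conj.
    by apply: jensen_disc; rewrite cnorm_conj.
  apply: circle_mean_eq => t _; congr ln.
  have -> : cis t - a = cis t * conjc (1 - conjc a * cis t).
    transitivity (cis t * (1 - a * conjc (cis t))).
      by rewrite cis_conjV; field; exact: cis_neq0.
    congr (_ * _); case: a {a1} => u v; case: (cis t) => x y.
    by apply/eqP; rewrite eq_complex /=; apply/andP; split; apply/eqP; ring.
  by rewrite cnormM cnorm_cis mul1r cnorm_conj.
have ap : 0 < cnorm a := lt_trans ltr01 a1.
have a0 : a != 0 by rewrite -cnorm_gt0.
have aV : cnorm a^-1 < 1 by rewrite cnormV invf_lt1.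
have := circle_meanD (circle_mean_cst (ln (cnorm a))) (jensen_disc aV).
rewrite addr0; apply: circle_mean_eq => t _ /=.
have q : 0 < cnorm (1 - a^-1 * cis t).
  rewrite (lt_le_trans _ (cnorm_ge_sub _ _))//.
  by rewrite cnorm1 cnormM cnorm_cis mulr1 subr_gt0.
rewrite -lnM ?posrE// -cnormM -cnormN; congr (ln (cnorm _)).
by rewrite mulrBr mulr1 mulVKf// opprB.
Qed.

End JensenCircle.

(** * Mean values over the torus *)

Section BoundedAbove.
Context d (T : measurableType d) (R : realType) (m : {measure set T -> \bar R}).

(** Trades integrability and value for one equation between extended reals about a nonnegative
    function, the form in which Tonelli's theorem applies. *)
Lemma integral_bounded_aboveP (D : set T) (M C v : R) (f : T -> R) :
  measurable D -> m D = M%:E -> measurable_fun D f -> (forall x, D x -> f x <= C) ->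
  (m.-integrable D (EFin \o f) /\ \int[m]_(x in D) f x = M * v) <->
  (\int[m]_(x in D) (C - f x)%:E = (M * (C - v))%:E)%E.
Proof.
move=> mD mM mf fC.
have mfe : measurable_fun D (EFin \o f) by exact/measurable_EFinP.
have Ci : m.-integrable D (EFin \o cst C).
  apply: measurable_bounded_integrable => //; first by rewrite mM ltry.
  exists `|C|; split; first exact: num_real.
  by move=> y /ltW Cy x Dx /=.
have CE : \int[m]_(x in D) cst C x = M * C.
  by rewrite Rintegral_cst// mM mulrC.
split => [[fi fv]|E].
  have Cfi : m.-integrable D (EFin \o (fun x => C - f x)).
    have -> : EFin \o (fun x => C - f x) = ((EFin \o cst C) \- (EFin \o f))%E.
      by apply/funext => x /=; rewrite EFinB.
    exact: integrableB.
  rewrite -[LHS]fineK; last exact: (integrable_fin_num mD Cfi).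
  congr EFin; rewrite -[LHS]/(\int[m]_(x in D) (C - f x)).
  by rewrite (RintegralB mD Ci fi) CE fv -mulrBr.
have Cfi : m.-integrable D (EFin \o (fun x => C - f x)).
  apply/integrableP; split.
    by apply/measurable_EFinP; exact: measurable_funB.
  rewrite (_ : (\int[m]_(x in D) _)%E = (M * (C - v))%:E) ?ltry// -E.
  apply: eq_integral => x /set_mem Dx.
  by rewrite /= ger0_norm// subr_ge0 fC.
have fE : f = (fun x => C - (C - f x)) by apply/funext => x; rewrite subKr.
have fi : m.-integrable D (EFin \o f).
  rewrite fE.
  have -> : EFin \o (fun x => C - (C - f x)) =
     ((EFin \o cst C) \- (EFin \o (fun x => (C - f x)%R)))%E.
    by apply/funext => x /=; rewrite EFinB.
  exact: integrableB.
split => //; rewrite fE (RintegralB mD Ci Cfi) CE /Rintegral E /=; ring.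
Qed.

End BoundedAbove.

Section Torus.
Context {R : realType}.
Local Notation mu := (@lebesgue_measure R).
Local Notation I := (`[0, 2 * pi]%classic : set R).
Local Notation mu2 := (mu \x mu)%E.

Definition torus_mean (f : R * R -> R) (v : R) :=
  mu2.-integrable (I `*` I) (EFin \o f) /\
  \int[mu2]_(z in I `*` I) f z = (2 * pi) ^+ 2 * v.

Lemma torus_measure : mu2 (I `*` I) = ((2 * pi) ^+ 2)%:E.
Proof.
rewrite product_measure1E//; try exact: measurable_itv.
transitivity (mu I * mu I)%E; first by [].
by rewrite circle_measure -EFinM expr2.
Qed.

(** Extended by zero off the square because Tonelli is applied on the whole plane. *)
Let patch C (f : R * R -> R) : R * R -> \bar R :=
  (fun z => (C - f z)%:E) \_ (I `*` I).

Let measurable_patch C (f : R * R -> R) : measurable_fun setT f ->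
  measurable_fun setT (patch C f).
Proof.
move=> mf; apply/(measurable_restrictT _ _).1.
  by apply: measurableX; exact: measurable_itv.
by apply/measurable_EFinP; apply: measurable_funB => //; exact: measurable_funTS.
Qed.

Let patch_ge0 C (f : R * R -> R) : (forall z, f z <= C) ->
  forall z, (0 <= patch C f z)%E.
Proof.
move=> fC z; rewrite /patch /restrict; case: ifP => // _.
by rewrite lee_fin subr_ge0.
Qed.

(** Common to both orders of integration. Here [k] is the inner integral of [C - f]; Tonelli makes
    it measurable, and the measurability of [g] on the circle is read off from it. *)
Let iterated_core (f : R * R -> R) (g : R -> R) (k : R -> \bar R) (C v : R) :
  measurable_fun setT f -> (forall z, f z <= C) ->
  measurable_fun setT k ->
  (\int[mu2]_z patch C f z = \int[mu]_s k s)%E ->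
  (forall s, I s -> k s = (2 * pi * (C - g s))%:E) ->
  (forall s, ~ I s -> k s = 0%E) ->
  (forall s, I s -> g s <= C) ->
  torus_mean f v <-> circle_mean g v.
Proof.
move=> mf fC mk fk kI k0 gC.
have p0 := @two_pi_gt0 R.
have mD2 : measurable (I `*` I) by apply: measurableX; exact: measurable_itv.
have fP := @integral_bounded_aboveP _ _ _ mu2 (I `*` I) _ C v f mD2
  torus_measure (measurable_funTS mf) (fun z _ => fC z).
pose G s := 2 * pi * g s.
have mG : measurable_fun I G.
  have mk' : measurable_fun I (fun s => 2 * pi * C - fine (k s)).
    apply: measurable_funB => //.
    apply: (measurableT_comp (fine_measurable measurableT)) => //.
    exact: measurable_funTS.
  apply: eq_measurable_fun mk' => s /set_mem Is.
  by rewrite kI//= mulrBr subKr.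
have GP := @integral_bounded_aboveP _ _ _ mu I _ (2 * pi * C) (2 * pi * v) G
  (measurable_itv _) circle_measure mG.
have {}GP := GP (fun s Is => ler_wpM2l (ltW p0) (gC s Is)).
have E : (\int[mu2]_(z in I `*` I) (C - f z)%:E =
    \int[mu]_(s in I) (2 * pi * C - G s)%:E)%E.
  rewrite integral_mkcond fk [RHS]integral_mkcond; apply: eq_integral => s _.
  rewrite /restrict; case: ifPn => [/set_mem Is|/negP Is].
    by rewrite kI// mulrBr.
  by rewrite k0// => Is'; apply: Is; rewrite inE.
have HG : (mu.-integrable I (EFin \o G) /\ \int[mu]_(x in I) G x = 2 * pi * (2 * pi * v))
   <-> circle_mean g v.
  split=> [Gm|/(circle_meanZ (2 * pi)) //].
  have := circle_meanZ (2 * pi)^-1 (Gm : circle_mean G _).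
  by rewrite mulKf ?gt_eqF//; apply: circle_mean_eq => s _; rewrite /G mulKf// gt_eqF.
apply: (iff_trans fP); apply: iff_trans HG; apply: iff_trans (iff_sym GP).
have -> : (2 * pi) ^+ 2 * (C - v) = 2 * pi * (2 * pi * C - 2 * pi * v) by ring.
by rewrite E.
Qed.

Lemma torus_mean_iterated1 (f : R * R -> R) (g : R -> R) (C v : R) :
  measurable_fun setT f -> (forall z, f z <= C) ->
  (forall s, I s -> circle_mean (fun t => f (s, t)) (g s)) ->
  torus_mean f v <-> circle_mean g v.
Proof.
move=> mf fC fg.
apply: (@iterated_core f g (fubini_F mu (patch C f)) C v) => //.
- apply: measurable_fun_fubini_tonelli_F; first exact: measurable_patch.
  exact: patch_ge0.
- apply: fubini_tonelli1; first exact: measurable_patch.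
  exact: patch_ge0.
- move=> s Is; have mfs : measurable_fun I (fun t => f (s, t)).
    by apply: measurable_funTS; exact: measurableT_comp.
  have P := @integral_bounded_aboveP _ _ _ mu I _ C (g s) (fun t => f (s, t))
    (measurable_itv _) circle_measure mfs (fun t _ => fC (s, t)).
  rewrite -(P.1 (fg s Is)) [RHS]integral_mkcond; apply: eq_integral => t _.
  by rewrite /patch /restrict in_setX (mem_set Is).
- move=> s Is; apply: integral0_eq => t _.
  rewrite /patch /restrict in_setX.
  by case: ifP => // /andP[/set_mem].
- move=> s Is; apply: (circle_mean_le (fg s Is) (circle_mean_cst C)) => t _.
  exact: fC.
Qed.

Lemma torus_mean_iterated2 (f : R * R -> R) (g : R -> R) (C v : R) :
  measurable_fun setT f -> (forall z, f z <= C) ->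
  (forall t, I t -> circle_mean (fun s => f (s, t)) (g t)) ->
  torus_mean f v <-> circle_mean g v.
Proof.
move=> mf fC fg.
apply: (@iterated_core f g (fubini_G mu (patch C f)) C v) => //.
- apply: measurable_fun_fubini_tonelli_G; first exact: measurable_patch.
  exact: patch_ge0.
- apply: fubini_tonelli2; first exact: measurable_patch.
  exact: patch_ge0.
- move=> t It; have mft : measurable_fun I (fun s => f (s, t)).
    by apply: measurable_funTS; exact: measurableT_comp.
  have P := @integral_bounded_aboveP _ _ _ mu I _ C (g t) (fun s => f (s, t))
    (measurable_itv _) circle_measure mft (fun s _ => fC (s, t)).
  rewrite -(P.1 (fg t It)) [RHS]integral_mkcond; apply: eq_integral => s _.
  by rewrite /patch /restrict in_setX (mem_set It) andbT.
- move=> t It; apply: integral0_eq => s _.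
  rewrite /patch /restrict in_setX.
  by case: ifP => // /andP[_ /set_mem].
- move=> t It; apply: (circle_mean_le (fg t It) (circle_mean_cst C)) => s _.
  exact: fC.
Qed.

End Torus.

(** The representative chosen by the quotient stays opaque: this identity and its nonzero
    denominator are all that is used of it. *)
Lemma repr_fraction (A : idomainType) (f : {fraction A}) (p q : A) : q != 0 ->
  f * FracField.tofrac q = FracField.tofrac p ->
  (repr f).1 * q = p * (repr f).2.
Proof.
move=> q0; rewrite -{1}[f]reprK; move: (repr f) => r.
unlock FracField.tofrac; rewrite -[X in X = _]FracField.pi_mul => /eqmodP /eqP /=.
rewrite /FracField.mulf !numden_Ratio ?(oner_neq0, mulr1, denom_ratioP)//.
by rewrite [RHS]mulrC.
Qed.

(** Over a domain, since it is applied first to polynomials in [x] with coefficients in [C[y]], then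
    to polynomials in [y] over [C]. *)
Lemma finitely_many_roots (A : idomainType) (p : {poly A}) : p != 0 ->
  exists s : seq A, forall x, root p x -> x \in s.
Proof.
have [n] := ubnP (size p); elim: n p => // n IH p pn p0.
have [[x px]|nx] := pselect (exists x, root p x); last first.
  by exists [::] => x px; case: nx; exists x.
have /factor_theorem [q pq] := px.
have q0 : q != 0 by apply: contra_neq p0 => q0; rewrite pq q0 mul0r.
have [|s sP] := IH q _ q0.
  move: pn; rewrite pq size_Mmonic ?monicXsubC// size_XsubC addn2/=.
  by rewrite ltnS.
exists (x :: s) => y; rewrite pq rootM root_XsubC inE orbC => /orP[->//|/sP ->].
by rewrite orbT.
Qed.

(** * Evaluation of rational functions on the torus *)

Section MahlerEval.
Context {R : realType}.
Local Notation mu := (@lebesgue_measure R).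
Local Notation I := (`[0, 2 * pi]%classic : set R).
Local Notation mu2 := (mu \x mu)%E.

Definition complex_measurable (f : R * R -> R[i]) :=
  measurable_fun setT (fun z => complex.Re (f z)) /\
  measurable_fun setT (fun z => complex.Im (f z)).

Lemma complex_measurable_cst (a : R[i]) : complex_measurable (fun=> a).
Proof. by split; exact: measurable_cst. Qed.

Lemma complex_measurableD (f g : R * R -> R[i]) :
  complex_measurable f -> complex_measurable g ->
  complex_measurable (fun z => f z + g z).
Proof.
move=> [f1 f2] [g1 g2]; split.
  rewrite [X in measurable_fun _ X](_ : _ = (fun z => complex.Re (f z) + complex.Re (g z))).
    exact: measurable_funD.
  by apply/funext => z; case: (f z) => ? ?; case: (g z).
rewrite [X in measurable_fun _ X](_ : _ = (fun z => complex.Im (f z) + complex.Im (g z))).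
  exact: measurable_funD.
by apply/funext => z; case: (f z) => ? ?; case: (g z).
Qed.

Lemma complex_measurableM (f g : R * R -> R[i]) :
  complex_measurable f -> complex_measurable g ->
  complex_measurable (fun z => f z * g z).
Proof.
move=> [f1 f2] [g1 g2]; split.
  rewrite [X in measurable_fun _ X](_ : _ = (fun z =>
     complex.Re (f z) * complex.Re (g z) - complex.Im (f z) * complex.Im (g z))).
    by apply: measurable_funB; exact: measurable_funM.
  by apply/funext => z; case: (f z) => ? ?; case: (g z).
rewrite [X in measurable_fun _ X](_ : _ = (fun z =>
   complex.Re (f z) * complex.Im (g z) + complex.Im (f z) * complex.Re (g z))).
  by apply: measurable_funD; exact: measurable_funM.
by apply/funext => z; case: (f z) => ? ?; case: (g z).
Qed.

Lemma complex_measurableX (f : R * R -> R[i]) n :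
  complex_measurable f -> complex_measurable (fun z => f z ^+ n).
Proof.
move=> mf; elim: n => [|n IH].
  by under eq_fun do rewrite expr0; exact: complex_measurable_cst.
by under eq_fun do rewrite exprS; exact: complex_measurableM.
Qed.

Lemma complex_measurable_sum (J : Type) (s : seq J) (f : J -> R * R -> R[i]) :
  (forall j, complex_measurable (f j)) ->
  complex_measurable (fun z => \sum_(j <- s) f j z).
Proof.
move=> mf; elim: s => [|j s IH].
  by under eq_fun do rewrite big_nil; exact: complex_measurable_cst.
by under eq_fun do rewrite big_cons; exact: complex_measurableD.
Qed.

Lemma complex_measurable_cis (g : R * R -> R) : measurable_fun setT g ->
  complex_measurable (fun z => cis (g z)).
Proof.
by move=> mg; split; apply: measurableT_comp mg;
  apply: continuous_measurable_fun; [exact: continuous_cos|exact: continuous_sin].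
Qed.

Lemma measurable_cnorm (f : R * R -> R[i]) : complex_measurable f ->
  measurable_fun setT (fun z => cnorm (f z)).
Proof.
move=> [f1 f2]; under eq_fun do rewrite cnormE.
apply: (measurableT_comp (continuous_measurable_fun (@sqrt_continuous R))).
by apply: measurable_funD; exact: measurable_funX.
Qed.

Lemma measurable_ln_cnorm2 (f : R * R -> R[i]) : complex_measurable f ->
  measurable_fun setT (fun z => ln (cnorm (f z))).
Proof.
by move=> mf; apply: (measurableT_comp (@measurable_ln R)); exact: measurable_cnorm.
Qed.

Lemma complex_measurable_eval (p : bipoly R) :
  complex_measurable (fun z => p.[cis z.1, cis z.2]).
Proof.
have -> : (fun z : R * R => p.[cis z.1, cis z.2]) = (fun z =>
    \sum_(i < size p) \sum_(j < size p`_i) p`_i`_j * cis z.2 ^+ j * cis z.1 ^+ i).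
  apply/funext => z; rewrite [p.[_] in LHS]horner_coef horner_sum; apply: eq_bigr => i _.
  rewrite hornerM -polyC_exp hornerC horner_coef mulr_suml.
  by apply: eq_bigr => j _.
apply: complex_measurable_sum => i; apply: complex_measurable_sum => j.
have m1 : complex_measurable (fun z => cis z.1).
  by apply: complex_measurable_cis; exact: measurable_fst.
have m2 : complex_measurable (fun z => cis z.2).
  by apply: complex_measurable_cis; exact: measurable_snd.
apply: complex_measurableM; last exact: complex_measurableX.
apply: complex_measurableM; last exact: complex_measurableX.
exact: complex_measurable_cst.
Qed.

Definition torus_zeros (d : bipoly R) : set (R * R) :=
  [set z | (I `*` I) z /\ d.[cis z.1, cis z.2] = 0].

Lemma measurable_torus_zeros (d : bipoly R) : measurable (torus_zeros d).
Proof.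
have mD2 : measurable (I `*` I) by apply: measurableX; exact: measurable_itv.
have -> : torus_zeros d = (I `*` I) `&`
    (fun z => cnorm d.[cis z.1, cis z.2]) @^-1` [set 0].
  apply/seteqP; split => z /= [Iz].
    by move=> ->; split => //; apply/eqP; rewrite cnorm_eq0.
  by move=> /eqP; rewrite cnorm_eq0 => /eqP.
apply: (measurable_funTS (measurable_cnorm (complex_measurable_eval d)) mD2).
exact: measurable_set1.
Qed.

Lemma cis_preimage_finite (s : seq R[i]) : finite_set [set t | I t /\ cis t \in s].
Proof.
elim: s => [|a s IH].
  by rewrite (_ : [set _ | _] = set0)//; apply/seteqP; split => t //= [].
apply: (@sub_finite_set _ _ ([set t | I t /\ cis t = a] `|` [set t | I t /\ cis t \in s])).
  by move=> t /= [It]; rewrite inE => /orP[/eqP|]; [left|right].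
by rewrite finite_setU; split => //; exact: cis_fiber_finite.
Qed.

(** For all but finitely many [s] the polynomial [d] at [x = cis s] is a nonzero polynomial in [y],
    so the section over [s] is finite. *)
Lemma torus_zeros_null (d : bipoly R) : d != 0 -> mu2 (torus_zeros d) = 0%E.
Proof.
move=> d0; rewrite /product_measure1 /=.
have [rs rsP] := finitely_many_roots d0.
(* The roots in [rs] are polynomials in [y]; the constant one [(cis s)%:P] is recovered from its
   coefficient of index [0]. *)
pose B := [set s | I s /\ cis s \in map (fun r : {poly R[i]} => r`_0) rs].
have cB : countable B by apply: finite_set_countable; exact: cis_preimage_finite.
have mB : measurable B by exact: countable_measurable.
have B0 : mu B = 0%E by exact: countable_lebesgue_measure0.
rewrite (ae_eq_integral (cst 0%E))//; first exact: integral0.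
- by apply: measurable_fun_xsection; exact: measurable_torus_zeros.
- exists B; split => // s /= /existsNP[_]; apply: contra_notP => Bs.
  have [Is|nIs] := pselect (I s); last first.
    rewrite (_ : xsection _ _ = set0) ?measure0//.
    by apply/seteqP; split => t //=; rewrite /xsection/= inE => -[[]].
  apply: countable_lebesgue_measure0; apply: finite_set_countable.
  have ds : d.[(cis s)%:P] != 0.
    apply/negP => /rsP sr; apply: Bs; split => //.
    by apply/mapP; exists (cis s)%:P => //; rewrite coefC.
  have [ys ysP] := finitely_many_roots ds.
  apply: sub_finite_set (cis_preimage_finite ys) => t.
  rewrite /xsection/= inE => -[[_ It] /= dt]; split => //.
  by apply: ysP; apply/rootP.
Qed.

(** A denominator of modulus one on the torus drops out of the integrand. It is applied with [q = 1]
    and with [q = x y]. *)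
Lemma mahler_fraction (f : birat R) (p q : bipoly R) v : q != 0 ->
  (forall s t, cnorm q.[cis s, cis t] = 1) ->
  f * FracField.tofrac q = FracField.tofrac p ->
  torus_mean (fun z => ln (cnorm p.[cis z.1, cis z.2])) v ->
  mahler f = v.
Proof.
move=> q0 q1 fpq [pint pv].
have E := repr_fraction q0 fpq.
set n := (repr f).1 in E; set d := (repr f).2 in E.
have d0 : d != 0 by exact: denom_ratioP.
pose Z := torus_zeros d.
have mZ : measurable Z := measurable_torus_zeros d.
have Z0 : mu2 Z = 0%E := torus_zeros_null d0.
have mD2 : measurable (I `*` I) by apply: measurableX; exact: measurable_itv.
pose g z := ln (complex.Re `|birat_eval f (cis z.1) (cis z.2)|).
pose h z := ln (cnorm p.[cis z.1, cis z.2]).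
have gE z : (I `*` I) z -> g z = (h \_ (~` Z)) z.
  move=> Iz; rewrite /g /h -/(cnorm _) /birat_eval -/n -/d.
  have := congr1 (fun u : bipoly R => cnorm u.[cis z.1, cis z.2]) E.
  rewrite !hornerM !cnormM q1 mulr1 cnormV => ->.
  rewrite /restrict; case: ifPn => [|/negP nZ].
    rewrite inE /= => dz; rewrite mulfK// cnorm_eq0.
    by apply/eqP => dz0; apply: dz.
  (* On [Z] division by zero gives [0] and then [ln 0 = 0], which is the value of the restriction
     there. *)
  have -> : d.[cis z.1, cis z.2] = 0.
    by apply: contrapT => dz; apply: nZ; rewrite inE => -[].
  by rewrite (_ : cnorm 0 = 0) ?invr0 ?mulr0 ?ln0//; apply/eqP; rewrite cnorm_eq0.
rewrite /mahler -[RHS](mulKf (x := (2 * pi) ^+ 2)); last first.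
  by rewrite expf_neq0// gt_eqF// two_pi_gt0.
congr (_ * _); rewrite -pv.
rewrite (@eq_Rintegral _ _ _ mu2 _ (h \_ (~` Z))); last by move=> z /set_mem; exact: gE.
rewrite -Rintegral_mkcondr -setDE /Rintegral; congr fine; apply/esym.
exact: (@negligible_integral _ _ _ mu2 _ _ _ mZ mD2 pint Z0).
Qed.

End MahlerEval.

(** * Reduction to one variable *)

Section Quadratics.
Context {R : realType}.
Local Notation I := (`[0, 2 * pi]%classic : set R).
Implicit Types (a b c : R[i]).

Lemma quadratic_roots (B C : R[i]) : exists a b, a + b = - B /\ a * b = C.
Proof.
pose d := sqrtC (B ^+ 2 - 4 * C).
have dE : d ^+ 2 = B ^+ 2 - 4 * C by rewrite sqrtCK.
exists ((- B + d) / 2), ((- B - d) / 2); split; first by field.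
transitivity ((B ^+ 2 - d ^+ 2) / 4); first by field.
by rewrite dE; field.
Qed.

Lemma jensen_quadratic c a b : c != 0 ->
  circle_mean (fun t => ln (cnorm (c * ((cis t - a) * (cis t - b)))))
    (ln (cnorm c) + (ln (Num.max 1 (cnorm a)) + ln (Num.max 1 (cnorm b)))).
Proof.
move=> c0.
pose Z := [set t | I t /\ cis t = a] `|` [set t | I t /\ cis t = b].
have cZ : countable Z.
  by apply: finite_set_countable; rewrite finite_setU; split; exact: cis_fiber_finite.
have cB u : complex_continuous (fun t : R => cis t - u).
  have -> : (fun t : R => cis t - u) = (fun t => - u + 1 * cis t).
    by apply/funext => t; rewrite mul1r addrC.
  exact: complex_continuous_affine.
apply: (circle_mean_ae cZ _ _ (circle_meanD (circle_mean_cst (ln (cnorm c)))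
    (circle_meanD (jensen a) (jensen b)))).
  apply: measurable_ln_cnorm; apply: complex_continuousM.
    exact: complex_continuous_cst.
  by apply: complex_continuousM; exact: cB.
move=> t It Zt /=; rewrite !cnormM.
have pa : 0 < cnorm (cis t - a).
  by rewrite cnorm_gt0 subr_eq0; apply/eqP => ta; apply: Zt; left.
have pb : 0 < cnorm (cis t - b).
  by rewrite cnorm_gt0 subr_eq0; apply/eqP => tb; apply: Zt; right.
have pc : 0 < cnorm c by rewrite cnorm_gt0.
have pab : 0 < cnorm (cis t - a) * cnorm (cis t - b) by rewrite mulr_gt0.
by rewrite -[in LHS]lnM ?posrE// -lnM ?posrE.
Qed.

(* The condition is the Schur-Cohn criterion for [y^2 - (a + b) y + a b]. *)
Lemma roots_separated a b :
  `|1 - cnorm (a * b) ^+ 2| <= cnorm (a + b - conjc (a + b) * (a * b)) ->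
  (cnorm a <= 1 /\ 1 <= cnorm b) \/ (cnorm b <= 1 /\ 1 <= cnorm a).
Proof.
set p := cnorm a; set q := cnorm b.
have p0 : 0 <= p by exact: cnorm_ge0.
have q0 : 0 <= q by exact: cnorm_ge0.
have -> : a + b - conjc (a + b) * (a * b) = a * (1 - (q ^+ 2)%:C) + b * (1 - (p ^+ 2)%:C).
  have -> : (q ^+ 2)%:C = b * conjc b.
    by rewrite rmorphXn/= -normc_cnorm sqr_normc.
  have -> : (p ^+ 2)%:C = a * conjc a.
    by rewrite rmorphXn/= -normc_cnorm sqr_normc.
  by rewrite rmorphD /=; ring.
rewrite cnormM -/p -/q => /le_trans /(_ (cnormD _ _)).
have nE (u : R) : cnorm (1 - u%:C) = `|1 - u|.
  by rewrite -cnorm_real rmorphB rmorph1.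
rewrite !cnormM !nE -/p -/q => H.
(* If both moduli are below [1], or both above, then [H] reduces to [1 + p q <= p + q], against
   [(1 - p) (1 - q) > 0]. *)
have [p1|p1] := ltP p 1; have [q1|q1] := ltP q 1.
- exfalso; have pq1 : p * q < 1 by nra.
  have pq0 : 0 <= p * q by rewrite mulr_ge0.
  have sq (u : R) : 0 <= u -> u < 1 -> 0 <= 1 - u ^+ 2 by move=> u0 u1; nra.
  move: H; rewrite (ger0_norm (sq _ p0 p1)) (ger0_norm (sq _ q0 q1)).
  rewrite (ger0_norm (sq _ pq0 pq1)).
  have -> : 1 - (p * q) ^+ 2 = (1 + p * q) * (1 - p * q) by ring.
  have -> : p * (1 - q ^+ 2) + q * (1 - p ^+ 2) = (p + q) * (1 - p * q) by ring.
  rewrite ler_pM2r ?subr_gt0//.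
  have : 0 < (1 - p) * (1 - q) by rewrite mulr_gt0// subr_gt0.
  by lra.
- by left; split => //; exact: ltW.
- by right; split => //; exact: ltW.
- have [q2|q2] := leP q 1; first by right.
  have [p2|p2] := leP p 1; first by left; split => //; exact: ltW.
  exfalso; have pq1 : 1 < p * q by nra.
  have sq (u : R) : 1 < u -> 1 - u ^+ 2 <= 0 by move=> u1; nra.
  move: H; rewrite (ler0_norm (sq _ p2)) (ler0_norm (sq _ q2)).
  rewrite (ler0_norm (sq _ pq1)).
  have -> : - (1 - (p * q) ^+ 2) = (1 + p * q) * (p * q - 1) by ring.
  have -> : p * - (1 - q ^+ 2) + q * - (1 - p ^+ 2) = (p + q) * (p * q - 1) by ring.
  rewrite ler_pM2r ?subr_gt0//.
  have : 0 < (p - 1) * (q - 1) by rewrite mulr_gt0// subr_gt0.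
  by lra.
Qed.

(** The radius [m] is the geometric mean of [p] and [q], so it separates them just as [1] does; both
    sides equal [ln q]. *)
Lemma ln_max_separated (p q m : R) : 0 <= p -> 0 < m -> p * q = m ^+ 2 ->
  p <= 1 -> 1 <= q ->
  ln m + (ln (Num.max 1 (p / m)) + ln (Num.max 1 (q / m))) =
  ln (Num.max 1 p) + ln (Num.max 1 q).
Proof.
move=> p0 m0 pq p1 q1.
have mm := ltW m0; have q0 : 0 <= q := le_trans ler01 q1.
have pm : p <= m by rewrite -(@ler_pXn2r _ 2%N) ?nnegrE// -pq expr2 ler_wpM2l// (le_trans p1).
have mq : m <= q by rewrite -(@ler_pXn2r _ 2%N) ?nnegrE// -pq expr2 ler_wpM2r// (le_trans p1).
rewrite max_l ?ler_pdivrMr ?mul1r// [in RHS]max_l// ln1 !add0r.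
rewrite !max_r ?ler_pdivlMr ?mul1r//.
by rewrite -lnM ?posrE ?divr_gt0 ?(lt_le_trans m0)// mulrC mulfVK// gt_eqF.
Qed.

(* Moving the circle [|y| = 1] to [|y| = |X|^2] crosses no root of
   [y^2 + B y + X^4]. *)
Lemma circle_mean_rescale (X B : R[i]) : X != 0 ->
  `|1 - cnorm (X ^+ 4) ^+ 2| <= cnorm (B - conjc B * X ^+ 4) ->
  exists g : R,
    circle_mean (fun t => ln (cnorm (cis t ^+ 2 + B * cis t + X ^+ 4))) g /\
    circle_mean (fun t => ln (cnorm (X ^+ 2 * cis t ^+ 2 + B * cis t + X ^+ 2))) g.
Proof.
move=> X0 sep.
have [a [b [ab1 ab2]]] := quadratic_roots B (X ^+ 4).
have X20 : X ^+ 2 != 0 by rewrite expf_neq0.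
have := @jensen_quadratic 1 a b (oner_neq0 _).
have := @jensen_quadratic (X ^+ 2) (a / X ^+ 2) (b / X ^+ 2) X20.
rewrite cnorm1 ln1 add0r => H1 H2.
exists (ln (Num.max 1 (cnorm a)) + ln (Num.max 1 (cnorm b))); split.
  apply: circle_mean_eq H2 => t _; congr (ln (cnorm _)).
  by rewrite mul1r -ab2 -[B]opprK -ab1; ring.
have -> : ln (Num.max 1 (cnorm a)) + ln (Num.max 1 (cnorm b)) =
   ln (cnorm (X ^+ 2)) + (ln (Num.max 1 (cnorm (a / X ^+ 2))) +
    ln (Num.max 1 (cnorm (b / X ^+ 2)))).
  rewrite (cnormM a) (cnormM b) cnormV.
  have m0 : 0 < cnorm (X ^+ 2) by rewrite cnorm_gt0.
  have pq : cnorm a * cnorm b = cnorm (X ^+ 2) ^+ 2.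
    by rewrite -cnormM ab2 -cnormX -exprM.
  have [] := @roots_separated a b.
    rewrite ab2 ab1; apply: le_trans sep _.
    by rewrite -cnormN rmorphN mulNr opprB opprK addrC.
  - move=> [p1 q1]; symmetry; apply: ln_max_separated => //; exact: cnorm_ge0.
  - move=> [q1 p1]; rewrite addrC [X in _ = _ + X]addrC; symmetry.
    apply: ln_max_separated => //; first exact: cnorm_ge0.
    by rewrite mulrC.
apply: circle_mean_eq H1 => t _; congr (ln (cnorm _)).
have -> : X ^+ 2 * ((cis t - a / X ^+ 2) * (cis t - b / X ^+ 2)) =
  X ^+ 2 * cis t ^+ 2 - (a + b) * cis t + (a * b) / X ^+ 2 by field.
rewrite ab1 ab2 mulNr opprK.
by have -> : X ^+ 4 / X ^+ 2 = X ^+ 2 by field.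
Qed.

End Quadratics.

(** * The polynomials on the torus and the rescaling of [Q_k] *)

Section Polynomials.
Context {R : realType}.
Local Notation I := (`[0, 2 * pi]%classic : set R).
Implicit Types (p q : bipoly R).

(** Provides the constant [C] for Tonelli. The summand [1] makes [ln (1 + S)] nonnegative, which
    covers the zeros of [p], where [ln 0 = 0]. *)
Lemma bipoly_ln_bounded p :
  exists C : R, forall z : R * R, ln (cnorm p.[cis z.1, cis z.2]) <= C.
Proof.
pose S := \sum_(i < size p) \sum_(j < size p`_i) cnorm p`_i`_j.
have S0 : 0 <= S by apply: sumr_ge0 => i _; apply: sumr_ge0 => j _; exact: cnorm_ge0.
have cS (n : nat) (F : 'I_n -> R[i]) : cnorm (\sum_i F i) <= \sum_i cnorm (F i).
  elim/big_ind2 : _ => //; first by rewrite -[0]/(0%:C) cnorm_real normr0.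
  by move=> a b c d ab cd; rewrite (le_trans (cnormD _ _))// lerD.
have pS (z : R * R) : cnorm p.[cis z.1, cis z.2] <= S.
  rewrite [p.[_]]horner_coef horner_sum (le_trans (cS _ _))//.
  apply: ler_sum => i _.
  rewrite hornerM -polyC_exp hornerC cnormM cnormX cnorm_cis expr1n mulr1.
  rewrite horner_coef (le_trans (cS _ _))//; apply: ler_sum => j _.
  by rewrite cnormM cnormX cnorm_cis expr1n mulr1.
exists (ln (1 + S)) => z.
have [/eqP p0|p0] := boolP (cnorm p.[cis z.1, cis z.2] == 0).
  by rewrite p0 ln0// ln_ge0// lerDl.
have p1 : 0 < cnorm p.[cis z.1, cis z.2] by rewrite lt_def p0 cnorm_ge0.
have pS1 : cnorm p.[cis z.1, cis z.2] <= 1 + S by rewrite (le_trans (pS z))// lerDr.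
by rewrite ler_ln ?posrE// (lt_le_trans p1).
Qed.

Lemma torus_mean_poly1 p (g : R -> R) (v : R) :
  (forall s, I s -> circle_mean (fun t => ln (cnorm p.[cis s, cis t])) (g s)) ->
  torus_mean (fun z => ln (cnorm p.[cis z.1, cis z.2])) v <-> circle_mean g v.
Proof.
move=> pg; have [C pC] := bipoly_ln_bounded p.
apply: (torus_mean_iterated1 _ _ pC) => //.
by apply: measurable_ln_cnorm2; exact: complex_measurable_eval.
Qed.

Lemma torus_mean_poly2 p (g : R -> R) (v : R) :
  (forall t, I t -> circle_mean (fun s => ln (cnorm p.[cis s, cis t])) (g t)) ->
  torus_mean (fun z => ln (cnorm p.[cis z.1, cis z.2])) v <-> circle_mean g v.
Proof.
move=> pg; have [C pC] := bipoly_ln_bounded p.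
apply: (torus_mean_iterated2 _ _ pC) => //.
by apply: measurable_ln_cnorm2; exact: complex_measurable_eval.
Qed.

Lemma eval2D p q (x y : R[i]) : (p + q).[x, y] = p.[x, y] + q.[x, y].
Proof. by rewrite !hornerD. Qed.
Lemma eval2N p (x y : R[i]) : (- p).[x, y] = - p.[x, y].
Proof. by rewrite !hornerN. Qed.
Lemma eval2M p q (x y : R[i]) : (p * q).[x, y] = p.[x, y] * q.[x, y].
Proof. by rewrite !hornerM. Qed.
Lemma eval2_exp p n (x y : R[i]) : (p ^+ n).[x, y] = p.[x, y] ^+ n.
Proof. by rewrite !horner_exp. Qed.
Lemma eval2Mn p n (x y : R[i]) : (p *+ n).[x, y] = p.[x, y] *+ n.
Proof. by rewrite !hornerMn. Qed.
Lemma eval2_X (x y : R[i]) : ('X : bipoly R).[x, y] = x.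
Proof. by rewrite hornerX hornerC. Qed.
Lemma eval2_Y (x y : R[i]) : ('Y : bipoly R).[x, y] = y.
Proof. by rewrite hornerC hornerX. Qed.
Lemma eval2C (c x y : R[i]) : (c%:P%:P : bipoly R).[x, y] = c.
Proof. by rewrite !hornerC. Qed.
Lemma eval2_1 (x y : R[i]) : (1 : bipoly R).[x, y] = 1.
Proof. by rewrite !hornerC. Qed.
Definition Qlin (k : R) (X : R[i]) : R[i] :=
  X ^+ 4 + k%:C * X ^+ 3 + 2 * k%:C * X ^+ 2 + k%:C * X + 1.
Lemma Q_eval k (x y : R[i]) :
  (Q_ k).[x, y] = y ^+ 2 + Qlin k x * y + x ^+ 4.
Proof.
have KE := eval2C k%:C x y; have YE := eval2_Y x y; have XE := eval2_X x y.
have oneE := eval2_1 x y.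
have two : (2 : bipoly R).[x, y] = 2 by rewrite eval2Mn eval2_1.
rewrite /Q_ /Qlin.
move: ((k%:C)%:P%:P : bipoly R) KE ('Y : bipoly R) YE ('X : bipoly R) XE
  (1 : bipoly R) oneE (2 : bipoly R) two => K KE Y YE X XE u uE T TE.
by rewrite !eval2D !eval2_exp eval2M !eval2D !eval2_exp !eval2M KE YE XE uE TE.
Qed.
Lemma Q_shift_eval k (x y : R[i]) :
  (Q_ k \Po ('X - 1)).[x, y] = y ^+ 2 + Qlin k (x - 1) * y + (x - 1) ^+ 4.
Proof.
rewrite horner_comp -Q_eval; congr (_.[_].[_]).
by rewrite hornerD hornerN hornerX hornerC polyCB.
Qed.
Lemma P_eval k (x y : R[i]) :
  (P_ k).[x, y] = (x + 1) * (y + 1) * (x + y) - k%:C * x * y.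
Proof.
have KE := eval2C k%:C x y; have YE := eval2_Y x y; have XE := eval2_X x y.
have oneE := eval2_1 x y; rewrite /P_.
move: ((k%:C)%:P%:P : bipoly R) KE ('Y : bipoly R) YE ('X : bipoly R) XE
  (1 : bipoly R) oneE => K KE Y YE X XE u uE.
by rewrite eval2D eval2N !eval2M !eval2D KE YE XE uE.
Qed.

(* With [y = (x - 1)^2 z] and [c = (1 + z) (1 + z^-1)], this is
   [z (x^2 ((x - 1)^2 + (k - 2) (x - 1) + 1) + c (x - 1)^2)]. *)
Definition Qscaled (k : R) : bipoly R :=
  let k := (k%:C)%:P%:P in let X := 'X - 1 in
  X ^+ 2 * 'Y ^+ 2
  + (X ^+ 4 + k * X ^+ 3 + 2 * k * X ^+ 2 + k * X + 1) * 'Y + X ^+ 2.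

Lemma Qscaled_eval k (x y : R[i]) :
  (Qscaled k).[x, y] = (x - 1) ^+ 2 * y ^+ 2 + Qlin k (x - 1) * y + (x - 1) ^+ 2.
Proof.
have KE := eval2C k%:C x y; have YE := eval2_Y x y.
have XE : ('X - 1 : bipoly R).[x, y] = x - 1 by rewrite eval2D eval2N eval2_X eval2_1.
have oneE := eval2_1 x y.
have two : (2 : bipoly R).[x, y] = 2 by rewrite eval2Mn eval2_1.
rewrite /Qscaled /Qlin.
move: ((k%:C)%:P%:P : bipoly R) KE ('Y : bipoly R) YE (1 : bipoly R) oneE
  (2 : bipoly R) two ('X - 1 : bipoly R) XE => K KE Y YE u uE T TE Z ZE.
rewrite !eval2D (eval2_exp Z) (eval2M (Z ^+ 2)) (eval2M (_ + u)).
by rewrite !eval2D !eval2_exp !eval2M KE YE ZE uE TE.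
Qed.

(** This is [x y R_k], free of denominators; the factor [x y] has modulus one on the torus. *)
Definition R_num (k : R) : bipoly R :=
  'X ^+ 2 * 'Y + 'Y + 'X * 'Y ^+ 2 + 'X + ((k - 4)%:C)%:P%:P * ('X * 'Y).

Lemma R_num_eval k (x y : R[i]) :
  (R_num k).[x, y] = x ^+ 2 * y + y + x * y ^+ 2 + x + (k - 4)%:C * (x * y).
Proof.
have KE := eval2C (k - 4)%:C x y; have YE := eval2_Y x y; have XE := eval2_X x y.
rewrite /R_num.
move: (((k - 4)%:C)%:P%:P : bipoly R) KE ('Y : bipoly R) YE ('X : bipoly R) XE
  => K KE Y YE X XE.
rewrite !eval2D (eval2M (X ^+ 2)) (eval2M X (Y ^+ 2)) !eval2_exp.
by rewrite !eval2M KE YE XE.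
Qed.

Lemma cis_sub1_sqr (s : R) : (2 - 2 * cos s)%:C = 2 - cis s - (cis s)^-1.
Proof.
rewrite -cis_conjV /cis; apply/eqP; rewrite eq_complex /=.
by apply/andP; split; apply/eqP; ring.
Qed.

(** With [t = |x - 1|^2] in [[0, 4]], the squares of the two sides differ by
    [t (1 - t)^2 k (k P - 5 S)], where [P = 1 + 2 t + 5 t^2 - t^3] and [S = 1 + t + t^2 + t^3] are
    nonnegative. For [k <= 0] both [k] and [k P - 5 S] are at most [0]. For [17 <= k] the
    factorization [17 P - 5 S = (4 - t) (22 t^2 + 8 t + 3)] decides; its zero [t = 4] is the point
    [x = -1]. *)
Lemma Q_separated k s : k <= 0 \/ 17 <= k ->
  `|1 - cnorm ((cis s - 1) ^+ 4) ^+ 2| <=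
  cnorm (Qlin k (cis s - 1) - conjc (Qlin k (cis s - 1)) * (cis s - 1) ^+ 4).
Proof.
move=> hk; set X := cis s - 1.
pose t := 2 - 2 * cos s.
have t0 : 0 <= t by rewrite /t; have := cos_le1 s; lra.
have t4 : t <= 4 by rewrite /t; have := cos_geN1 s; lra.
have x0 := cis_neq0 s.
have tE := cis_sub1_sqr s; rewrite -/t in tE.
have XJ : conjc X = (cis s)^-1 - 1
    by rewrite /X rmorphB rmorph1 -[Y in Y - _ = _]/(conjc (cis s)) cis_conjV.
have X2 : (cnorm X ^+ 2)%:C = t%:C.
  rewrite rmorphXn /= -normc_cnorm sqr_normc XJ tE /X; field.
  exact: x0.
have nX : cnorm (X ^+ 4) ^+ 2 = t ^+ 4.
  rewrite cnormX -exprM mulnC exprM; congr (_ ^+ 4).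
  exact: (complexI X2).
rewrite nX -(@ler_pXn2r _ 2%N) ?nnegrE ?cnorm_ge0//.
rewrite real_normK ?num_real//.
have -> : cnorm (Qlin k X - conjc (Qlin k X) * X ^+ 4) ^+ 2 =
  (1 - t ^+ 4) ^+ 2 + t * k * (1 - t) ^+ 2 *
    (k * (1 + 2 * t + 5 * t ^+ 2 - t ^+ 3) - 5 * (1 + t + t ^+ 2 + t ^+ 3)).
  pose a := cos s + t ^+ 2 * cos s + k * (cos s ^+ 2 - sin s ^+ 2 - cos s).
  pose b := - sin s + t ^+ 2 * sin s + k * (2 * cos s * sin s - sin s).
  have XX : X ^+ 2 = - (t%:C * cis s) by rewrite tE /X; field.
  have X4 : X ^+ 4 = (t ^+ 2)%:C * cis s ^+ 2.
    by rewrite -[4%N]/(2 * 2)%N exprM XX sqrrN exprMn rmorphXn.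
  have abE : (cis s)^-1 + (t ^+ 2)%:C * cis s + k%:C * (cis s ^+ 2 - cis s) = a +i* b.
    rewrite -cis_conjV /cis expr2; apply/eqP; rewrite eq_complex /= /a /b.
    by apply/andP; split; apply/eqP; ring.
  (* Writing [x = cis s], the terms with [k] sum to [k X (X + 1)^2 = k (x - 1) x^2], and
     [X^4 = t^2 x^2]; thus a factor [x] of modulus one splits off. *)
  have QE : Qlin k X = cis s * (a +i* b).
    rewrite -abE /Qlin X4.
    have -> : X ^+ 3 = X ^+ 2 * X by rewrite exprSr.
    have -> : X ^+ 2 = cis s ^+ 2 - 2 * cis s + 1 by rewrite /X; ring.
    by rewrite /X; field.
  rewrite QE X4 rmorphM -[Y in _ - Y * _ * _]/(conjc (cis s)) cis_conjV
    -[Y in _ - _ * Y * _]/(a -i* b).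
  have -> : cis s * (a +i* b) - (cis s)^-1 * (a -i* b) * ((t ^+ 2)%:C * cis s ^+ 2) =
    cis s * (((1 - t ^+ 2) * a) +i* ((1 + t ^+ 2) * b)).
    transitivity (cis s * ((a +i* b) - (t ^+ 2)%:C * (a -i* b))); first by field.
    congr (_ * _); apply/eqP; rewrite eq_complex /=.
    by apply/andP; split; apply/eqP; ring.
  rewrite cnormM cnorm_cis mul1r cnorm_sqr /=.
  have -> : ((1 + t ^+ 2) * b) ^+ 2 =
     (1 - cos s ^+ 2) * ((1 + t ^+ 2) * (- 1 + t ^+ 2 + k * (2 * cos s - 1))) ^+ 2.
    by rewrite -sin2cos2 /b; ring.
  have -> : a = cos s + t ^+ 2 * cos s + k * (2 * cos s ^+ 2 - 1 - cos s).
    by rewrite /a sin2cos2; ring.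
  have -> : cos s = 1 - t / 2 by rewrite /t; field.
  by field.
set P := 1 + 2 * t + 5 * t ^+ 2 - t ^+ 3; set S := 1 + t + t ^+ 2 + t ^+ 3.
have t2 : 0 <= t ^+ 2 by rewrite sqr_ge0.
have P0 : 0 <= P.
  have -> : P = 1 + 2 * t + t ^+ 2 * (5 - t) by rewrite /P; ring.
  have : 0 <= t ^+ 2 * (5 - t) by rewrite mulr_ge0//; lra.
  by lra.
have S0 : 0 <= S.
  by have : 0 <= t ^+ 3 by [rewrite exprn_ge0]; rewrite /S; lra.
have kP : 0 <= k * (k * P - 5 * S).
  case: hk => hk.
    rewrite mulr_le0//; have : k * P <= 0 by rewrite mulr_le0_ge0.
    by lra.
  have : 0 <= 17 * P - 5 * S.
    have -> : 17 * P - 5 * S = (4 - t) * (22 * t ^+ 2 + 8 * t + 3).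
      by rewrite /P /S; ring.
    by rewrite mulr_ge0 ?subr_ge0//; lra.
  have : 17 * P <= k * P by rewrite ler_wpM2r.
  by move=> ? ?; rewrite mulr_ge0//; lra.
have -> : t * k * (1 - t) ^+ 2 * (k * P - 5 * S) =
  t * (1 - t) ^+ 2 * (k * (k * P - 5 * S)) by ring.
by rewrite lerDl mulr_ge0// mulr_ge0// sqr_ge0.
Qed.

Lemma mahler_polynomial p (v : R) :
  torus_mean (fun z => ln (cnorm p.[cis z.1, cis z.2])) v ->
  mahler (FracField.tofrac p) = v.
Proof.
apply: (@mahler_fraction _ _ p 1); first exact: oner_neq0.
  by move=> s t; rewrite eval2_1 cnorm1.
by rewrite rmorph1 mulr1.
Qed.

(** The shifted [Q_k] and [Qscaled] share the inner mean [g s] for every [s]. The equivalences are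
    used in the direction from [h] back to [g]: the torus mean of [Qscaled] transfers the value [v]
    from one order of integration to the other. *)
Lemma mahler_Q_shift (k : R) (h : R -> R) (v : R) : k <= 0 \/ 17 <= k ->
  (forall t, I t -> circle_mean (fun s => ln (cnorm (Qscaled k).[cis s, cis t])) (h t)) ->
  circle_mean h v -> mahler (FracField.tofrac (Q_ k \Po ('X - 1))) = v.
Proof.
move=> hk Hh hv; apply: mahler_polynomial.
have /choice [g gP] : forall s, exists g,
    circle_mean (fun t => ln (cnorm (Q_ k \Po ('X - 1)).[cis s, cis t])) g /\
    circle_mean (fun t => ln (cnorm (Qscaled k).[cis s, cis t])) g.
  move=> s; have [X0|X0] := eqVneq (cis s - 1) 0.
    (* At [x = 1] no rescaling is possible, but the two polynomials degenerate to [y (y + 1)] and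
       [y], both of mean [0]. *)
    have H := @jensen_quadratic R 1 0 (-1) (oner_neq0 _).
    have c0 : cnorm 0 = 0 :> R by apply/eqP; rewrite cnorm_eq0.
    rewrite cnormN !cnorm1 c0 maxxx max_l// ln1 !addr0 in H.
    exists 0; split.
      apply: circle_mean_eq H => t _; congr (ln (cnorm _)).
      by rewrite Q_shift_eval X0 /Qlin !expr0n /= !mulr0 !add0r; ring.
    apply: circle_mean_eq (circle_mean_cst 0) => t _.
    rewrite Qscaled_eval X0 /Qlin !expr0n /= !mulr0 !add0r mul0r add0r addr0 mul1r.
    by rewrite cnorm_cis ln1.
  have [g [g1 g2]] := circle_mean_rescale X0 (Q_separated s hk).
  exists g; split.
    by apply: circle_mean_eq g1 => t _; rewrite Q_shift_eval.
  by apply: circle_mean_eq g2 => t _; rewrite Qscaled_eval.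
apply/(torus_mean_poly1 _ (fun s _ => (gP s).1)).
apply/(torus_mean_poly1 _ (fun s _ => (gP s).2)).
exact/(torus_mean_poly2 _ Hh).
Qed.

End Polynomials.

(** * The mean in [x] for a fixed second variable *)

Section FixedTheta.
Context {R : realType}.
Local Notation I := (`[0, 2 * pi]%classic : set R).
Implicit Types (a b : R[i]) (s u : R).

Lemma circle_mean_lnM (f g : R -> R[i]) (v w : R) :
  complex_continuous f -> complex_continuous g ->
  countable [set t | I t /\ (f t = 0 \/ g t = 0)] ->
  circle_mean (fun t => ln (cnorm (f t))) v ->
  circle_mean (fun t => ln (cnorm (g t))) w ->
  circle_mean (fun t => ln (cnorm (f t * g t))) (v + w).
Proof.
move=> cf cg cZ fv gw; apply: (circle_mean_ae cZ _ _ (circle_meanD fv gw)).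
  by apply: measurable_ln_cnorm; exact: complex_continuousM.
move=> t It nZ /=; rewrite cnormM.
have f0 : f t != 0 by apply/eqP => f0; apply: nZ; split => //; left.
have g0 : g t != 0 by apply/eqP => g0; apply: nZ; split => //; right.
by rewrite lnM// posrE cnorm_gt0.
Qed.

Definition squad s (t : R) : R[i] := cis t ^+ 2 - s%:C * cis t + s%:C.

Lemma squad_continuous s : complex_continuous (squad s).
Proof.
have -> : squad s = (fun t => (s%:C + (- s%:C) * cis t) + cis t * cis t).
  by apply/funext => t; rewrite /squad; ring.
apply: complex_continuousD; first exact: complex_continuous_affine.
by apply: complex_continuousM; exact: complex_continuous_cis.
Qed.

Lemma squad_roots s : exists a b, [/\ a + b = s%:C, a * b = s%:C &
  forall t, squad s t = (cis t - a) * (cis t - b)].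
Proof.
have [a [b [ab1 ab2]]] := quadratic_roots (- s%:C) s%:C.
rewrite opprK in ab1; exists a, b; split=> // t.
by rewrite /squad -{1}ab1 -ab2; ring.
Qed.

Lemma squad_mean_roots s a b : a + b = s%:C -> a * b = s%:C ->
  circle_mean (fun t => ln (cnorm (squad s t)))
    (ln (Num.max 1 (cnorm a)) + ln (Num.max 1 (cnorm b))).
Proof.
move=> ab1 ab2; have := @jensen_quadratic R 1 a b (oner_neq0 _).
rewrite cnorm1 ln1 add0r; apply: circle_mean_eq => t _; congr (ln (cnorm _)).
by rewrite /squad -{1}ab1 -ab2; ring.
Qed.

Lemma squad_zeros s : finite_set [set t | I t /\ squad s t = 0].
Proof.
have [a [b [_ _ sE]]] := squad_roots s.
apply: (@sub_finite_set _ _ ([set t | I t /\ cis t = a] `|` [set t | I t /\ cis t = b])).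
  move=> t /= [It]; rewrite sE => /eqP; rewrite mulf_eq0 !subr_eq0.
  by move=> /orP[/eqP|/eqP]; [left|right].
by rewrite finite_setU; split; exact: cis_fiber_finite.
Qed.

Lemma squadM_mean s u (v w : R) :
  circle_mean (fun t => ln (cnorm (squad s t))) v ->
  circle_mean (fun t => ln (cnorm (squad u t))) w ->
  circle_mean (fun t => ln (cnorm (squad s t * squad u t))) (v + w).
Proof.
apply: circle_mean_lnM; try exact: squad_continuous.
apply: finite_set_countable.
apply: (@sub_finite_set _ _ ([set t | I t /\ squad s t = 0] `|`
    [set t | I t /\ squad u t = 0])).
  by move=> t /= [It []]; [left|right].
by rewrite finite_setU; split; exact: squad_zeros.
Qed.

(** Each factor is [x^2 - s (x - 1)], so the product is [x^4 - (s + u) x^2 (x - 1) + s u (x - 1)^2];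
    on the other side [(x - 1)^2 + (k - 2) (x - 1) + 1 = x^2 - (4 - k) (x - 1)]. *)
Lemma Qscaled_factor (k s u t x : R) : s + u = 4 - k -> s * u = 2 + 2 * cos t ->
  cnorm (Qscaled k).[cis x, cis t] = cnorm (squad s x * squad u x).
Proof.
move=> su1 su2.
have tE : (2 + 2 * cos t)%:C = 2 + cis t + (cis t)^-1.
  rewrite -cis_conjV /cis; apply/eqP; rewrite eq_complex /=.
  by apply/andP; split; apply/eqP; ring.
have E1 : s%:C + u%:C = 4 - k%:C by rewrite -rmorphD su1 rmorphB rmorph_nat.
have E2 : s%:C * u%:C = 2 + cis t + (cis t)^-1 by rewrite -rmorphM su2.
rewrite Qscaled_eval -[RHS]mul1r -(cnorm_cis t) -cnormM; congr cnorm.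
have -> : squad s x * squad u x = cis x ^+ 4 -
   (s%:C + u%:C) * cis x ^+ 2 * (cis x - 1) + (s%:C * u%:C) * (cis x - 1) ^+ 2.
  by rewrite /squad; ring.
rewrite E1 E2 /Qlin; move: (cis x) (cis t) (cis_neq0 t) => X Y Y0.
by field.
Qed.

(** The roots are conjugate with product [s], so their modulus is at most [1]. *)
Lemma squad_mean_01 s : 0 <= s <= 1 ->
  circle_mean (fun t => ln (cnorm (squad s t))) 0.
Proof.
move=> /andP[s0 s1].
pose r := Num.sqrt (4 * s - s ^+ 2).
have rr : r ^+ 2 = 4 * s - s ^+ 2 by rewrite sqr_sqrtr//; nra.
pose a : R[i] := (s / 2) +i* (r / 2).
have na : cnorm a <= 1.
  rewrite -(@ler_pXn2r _ 2%N) ?nnegrE ?cnorm_ge0// expr1n cnorm_sqr /=.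
  by rewrite !expr_div_n rr; lra.
have := @squad_mean_roots s a (conjc a).
rewrite cnorm_conj !max_l// ln1 addr0; apply.
  by apply/eqP; rewrite eq_complex /=; apply/andP; split; apply/eqP; field.
apply/eqP; rewrite eq_complex /=; apply/andP; split; apply/eqP; last by field.
by transitivity ((s ^+ 2 + r ^+ 2) / 4); [field|rewrite rr; field].
Qed.

Lemma squad_mean_real s r : r ^+ 2 = s ^+ 2 - 4 * s ->
  circle_mean (fun t => ln (cnorm (squad s t)))
    (ln (Num.max 1 `|(s + r) / 2|) + ln (Num.max 1 `|(s - r) / 2|)).
Proof.
move=> rr; rewrite -!cnorm_real; apply: squad_mean_roots.
  by rewrite -rmorphD; congr (_%:C); field.
rewrite -rmorphM; congr (_%:C).
by transitivity ((s ^+ 2 - r ^+ 2) / 4); [field|rewrite rr; field].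
Qed.

(** The roots are real, both are at least [1], and their product is [s]. *)
Lemma squad_mean_ge4 s : 4 <= s ->
  circle_mean (fun t => ln (cnorm (squad s t))) (ln s).
Proof.
move=> s4; pose r := Num.sqrt (s ^+ 2 - 4 * s).
have rr : r ^+ 2 = s ^+ 2 - 4 * s by rewrite sqr_sqrtr//; nra.
have r0 : 0 <= r by rewrite sqrtr_ge0.
have rs : r <= s - 2 by rewrite -(@ler_pXn2r _ 2%N) ?nnegrE// ?rr; [nra|lra].
have := squad_mean_real rr.
rewrite !ger0_norm ?divr_ge0//; try lra.
rewrite !max_r; try lra.
rewrite -lnM ?posrE; try lra.
have -> // : (s + r) / 2 * ((s - r) / 2) = s.
by transitivity ((s ^+ 2 - r ^+ 2) / 4); [field|rewrite rr; field].
Qed.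

(** The roots are real of opposite signs. The negative one leaves the disc through [-1], where the
    quadratic equals [1 - 2 s]; hence the bound [1 / 2]. *)
Lemma squad_mean_neg_small s : 0 <= s <= 2^-1 ->
  circle_mean (fun t => ln (cnorm (squad (- s) t))) 0.
Proof.
move=> /andP[s0 s1]; pose r := Num.sqrt (s ^+ 2 + 4 * s).
have rr : r ^+ 2 = (- s) ^+ 2 - 4 * (- s).
  by rewrite sqr_sqrtr; [ring|nra].
have r0 : 0 <= r by rewrite sqrtr_ge0.
have rs : r <= 2 - s by rewrite -(@ler_pXn2r _ 2%N) ?nnegrE// ?rr; [nra|lra].
have := squad_mean_real rr.
rewrite !max_l ?ln1 ?addr0// ler_norml; apply/andP; split; lra.
Qed.

(** Past that bound only the negative root counts; the positive one stays at most [1]. *)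
Lemma squad_mean_neg_large s : 2^-1 <= s ->
  circle_mean (fun t => ln (cnorm (squad (- s) t)))
    (ln ((s + Num.sqrt (s ^+ 2 + 4 * s)) / 2)).
Proof.
move=> s1; set r := Num.sqrt (s ^+ 2 + 4 * s).
have s0 : 0 <= s by lra.
have rr : r ^+ 2 = (- s) ^+ 2 - 4 * (- s).
  by rewrite sqr_sqrtr; [ring|nra].
have r0 : 0 <= r by rewrite sqrtr_ge0.
have sr : 2 - s <= r.
  have [s2|s2] := leP s 2; last by lra.
  by rewrite -(@ler_pXn2r _ 2%N) ?nnegrE// ?rr; [nra|lra].
have rs : r <= s + 2 by rewrite -(@ler_pXn2r _ 2%N) ?nnegrE// ?rr; [nra|lra].
have sr' : s <= r by rewrite -(@ler_pXn2r _ 2%N) ?nnegrE// ?rr; nra.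
have := squad_mean_real rr.
rewrite max_l; last by rewrite ler_norml; apply/andP; split; lra.
rewrite ln1 add0r ler0_norm; last by lra.
rewrite max_r; last by lra.
by have -> : - ((- s - r) / 2) = (s + r) / 2 by field.
Qed.

End FixedTheta.

(** * Inner means in terms of the larger root *)

Section Families.
Context {R : realType}.

(** The larger root of [T^2 - A T + c] when the discriminant is nonnegative. *)
Definition big_root (A c : R) : R := (A + Num.sqrt (A ^+ 2 - 4 * c)) / 2.

Lemma big_root_eq A c : 4 * c <= A ^+ 2 ->
  big_root A c ^+ 2 = A * big_root A c - c.
Proof.
move=> cA; have rr : Num.sqrt (A ^+ 2 - 4 * c) ^+ 2 = A ^+ 2 - 4 * c.
  by rewrite sqr_sqrtr// subr_ge0.
rewrite /big_root; move: (Num.sqrt _) rr => r rr.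
transitivity ((A ^+ 2 + 2 * A * r + r ^+ 2) / 4); first by field.
by rewrite rr; field.
Qed.

Lemma big_root_ge A c : A / 2 <= big_root A c.
Proof. by rewrite /big_root ler_pM2r ?invr_gt0// lerDl sqrtr_ge0. Qed.

Lemma two_cos_bound (t : R) : 0 <= 2 + 2 * cos t <= 4.
Proof. by have := cos_le1 t; have := cos_geN1 t; lra. Qed.

(** Since [5 <= A] and [c <= 4], the roots satisfy [4 <= T] and [0 <= A - T <= 1]; the extreme case
    [A = 5], [c = 4] gives exactly [4] and [1]. *)
Lemma Qscaled_mean_neg k (t : R) : k <= -1 ->
  circle_mean (fun s => ln (cnorm (Qscaled k).[cis s, cis t]))
    (ln (big_root (4 - k) (2 + 2 * cos t))).
Proof.
move=> k1; set c := 2 + 2 * cos t; set A := 4 - k.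
have /andP[c0 c4] : 0 <= c <= 4 by exact: two_cos_bound.
have A5 : 5 <= A by rewrite /A; lra.
have cA : 4 * c <= A ^+ 2 by nra.
have := big_root_eq cA; set T := big_root A c => TE.
have T4 : 4 <= T.
  have r3 : 3 <= Num.sqrt (A ^+ 2 - 4 * c).
    by rewrite -(@ler_pXn2r _ 2%N) ?nnegrE ?sqrtr_ge0// sqr_sqrtr; nra.
  by rewrite /T /big_root; lra.
have S01 : 0 <= A - T <= 1.
  have S0 : T * (A - T) = c by rewrite mulrBr mulrC -expr2 TE; ring.
  by apply/andP; split; nra.
have := squadM_mean (squad_mean_01 S01) (squad_mean_ge4 T4).
rewrite add0r; apply: circle_mean_eq => s _; rewrite (Qscaled_factor _ (s := A - T) (u := T))//.
  by rewrite /A; ring.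
by rewrite mulrBl -expr2 TE -/c; ring.
Qed.

(** Now the parameters are [-T] and [-(A - T)] with [A = k - 4]. As [12 <= T] and [c <= 4], the
    second is small enough to contribute nothing. *)
Lemma Qscaled_mean_pos k (t : R) : 17 <= k ->
  let T := big_root (k - 4) (2 + 2 * cos t) in
  circle_mean (fun s => ln (cnorm (Qscaled k).[cis s, cis t]))
    (ln ((T + Num.sqrt (T ^+ 2 + 4 * T)) / 2)).
Proof.
move=> k1; rewrite /=; set c := 2 + 2 * cos t; set A := k - 4.
have /andP[c0 c4] : 0 <= c <= 4 by exact: two_cos_bound.
have A13 : 13 <= A by rewrite /A; lra.
have cA : 4 * c <= A ^+ 2 by nra.
have := big_root_eq cA; set T := big_root A c => TE.
have T12 : 12 <= T.
  have r11 : 11 <= Num.sqrt (A ^+ 2 - 4 * c).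
    by rewrite -(@ler_pXn2r _ 2%N) ?nnegrE ?sqrtr_ge0// sqr_sqrtr; nra.
  by rewrite /T /big_root; lra.
have S01 : 0 <= A - T <= 2^-1.
  have S0 : T * (A - T) = c by rewrite mulrBr mulrC -expr2 TE; ring.
  by apply/andP; split; nra.
have T1 : 2^-1 <= T by lra.
have := squadM_mean (squad_mean_neg_small S01) (squad_mean_neg_large T1).
rewrite add0r; apply: circle_mean_eq => s _.
rewrite (Qscaled_factor _ (s := - (A - T)) (u := - T))//.
  by rewrite /A; ring.
by rewrite mulrNN mulrBl -expr2 TE -/c; ring.
Qed.

(* [A + 2 Re (conj e z) = K |z + e / K|^2] on [|z| = 1], where [K] is the larger
   root of [K^2 - A K + |e|^2]. *)
Lemma circle_mean_ln_harmonic (A : R) (e : R[i]) : 0 < A -> 4 * cnorm e ^+ 2 < A ^+ 2 ->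
  circle_mean (fun t => ln (A + 2 * complex.Re (conjc e * cis t)))
    (ln (big_root A (cnorm e ^+ 2))).
Proof.
move=> A0 eA; have := big_root_eq (ltW eA); have := big_root_ge A (cnorm e ^+ 2).
set K := big_root _ _ => KA KE; clearbody K.
have K0 : 0 < K by lra.
have e0 := cnorm_ge0 e.
have eK : cnorm e < K.
  have A0' := ltW A0.
  have : 2 * cnorm e < A by rewrite -(@ltr_pXn2r _ 2%N) ?nnegrE ?mulr_ge0// exprMn; lra.
  by lra.
have K0' : K != 0 by rewrite gt_eqF.
have r1 : cnorm (- (e / K%:C)) < 1.
  by rewrite cnormN cnormM cnormV cnorm_real gtr0_norm// ltr_pdivrMr// mul1r.
have := circle_meanD (circle_mean_cst (ln K)) (circle_meanZ 2 (jensen (- (e / K%:C)))).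
rewrite max_l ?ltW// ln1 mulr0 addr0; apply: circle_mean_eq => t _ /=.
set w := cis t - _.
have w0 : 0 < cnorm w.
  rewrite (lt_le_trans _ (cnorm_ge_sub _ _))// cnorm_cis subr_gt0//.
rewrite mulr_natl -lnXn// -lnM ?posrE ?exprn_gt0//; congr ln.
have eKE : e / K%:C = (K^-1)%:C * e by rewrite mulrC fmorphV.
rewrite /w opprK eKE cnorm_sqr; move: KE (cos2Dsin2 t); rewrite cnorm_sqr /=.
case: e {eA KA e0 eK r1 w w0 eKE} => u v /=.
move: (cos t) (sin t) => x y KE xy.
transitivity (K * (x ^+ 2 + y ^+ 2) + 2 * (u * x + v * y) + (u ^+ 2 + v ^+ 2) / K).
  by field.
rewrite xy; have -> : u ^+ 2 + v ^+ 2 = A * K - K ^+ 2 by rewrite KE; ring.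
by field.
Qed.

End Families.

Lemma field_clear_denominators (F : fieldType) (x y c : F) : x != 0 -> y != 0 ->
  (x + x^-1 + y + y^-1 + c) * (x * y) =
  x ^+ 2 * y + y + x * y ^+ 2 + x + c * (x * y).
Proof. by move=> x0 y0; field; rewrite x0 y0. Qed.

Lemma tofrac_clear_denominators (A : idomainType) (X Y K : A) : X != 0 -> Y != 0 ->
  let F := @FracField.tofrac A in
  (F X + (F X)^-1 + F Y + (F Y)^-1 + F K) * F (X * Y) =
  F (X ^+ 2 * Y + Y + X * Y ^+ 2 + X + K * (X * Y)).
Proof.
rewrite /= -!(tofrac_eq0 (R := A)) => x0 y0.
rewrite !tofracD (tofracM (X ^+ 2)) (tofracM X (Y ^+ 2)) !tofracXn !tofracM.
exact: field_clear_denominators.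
Qed.

(** * Inner means of [P_k] and [R_k] *)

Section RandP.
Context {R : realType}.
Local Notation I := (`[0, 2 * pi]%classic : set R).

Lemma harmonic_gt0 (A : R) (e : R[i]) (t : R) : 0 < A -> 4 * cnorm e ^+ 2 < A ^+ 2 ->
  0 < A + 2 * complex.Re (conjc e * cis t).
Proof.
move=> A0 eA; have := cnorm_sqr (conjc e * cis t).
rewrite cnormM cnorm_conj cnorm_cis mulr1.
move: (complex.Re _) (complex.Im _) => u v uv.
have v0 : 0 <= v ^+ 2 by exact: sqr_ge0.
rewrite ltNge; apply/negP => Au.
have : A ^+ 2 <= (- (2 * u)) ^+ 2 by rewrite ler_pXn2r ?nnegrE ?(ltW A0)//; lra.
by rewrite sqrrN exprMn; lra.
Qed.

Lemma cnorm_cisM (t : R) (z : R[i]) : cnorm (cis t * z) = cnorm z.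
Proof. by rewrite cnormM cnorm_cis mul1r. Qed.

Lemma harmonicE (A : R) (e : R[i]) (t : R) :
  (A + 2 * complex.Re (conjc e * cis t))%:C = A%:C + conjc e * cis t + e * (cis t)^-1.
Proof.
rewrite -cis_conjV /cis; case: e => u v; apply/eqP; rewrite eq_complex /=.
by apply/andP; split; apply/eqP; ring.
Qed.

Lemma circle_mean_ln_cnorm_harmonic (A : R) (e : R[i]) (f : R -> R[i]) : 0 < A ->
  4 * cnorm e ^+ 2 < A ^+ 2 ->
  (forall t, cnorm (f t) = cnorm (A%:C + conjc e * cis t + e * (cis t)^-1)) ->
  circle_mean (fun t => ln (cnorm (f t))) (ln (big_root A (cnorm e ^+ 2))).
Proof.
move=> A0 eA fE; apply: circle_mean_eq (circle_mean_ln_harmonic A0 eA) => t _.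
by rewrite fE -harmonicE cnorm_real gtr0_norm// harmonic_gt0.
Qed.

Lemma cnorm_1Dcis (s : R) : cnorm (1 + cis s) ^+ 2 = 2 + 2 * cos s.
Proof. by rewrite cnorm_sqr /= add0r sin2cos2; ring. Qed.

(** On the torus [- P_k / (x y) = A + 2 Re (conj e y)] with [A = k - |1 + x|^2] and [e = - (1 + x)];
    [8 < k] gives [4 < A], so this is positive. *)
Lemma mahler_P (k v : R) : 8 < k ->
  circle_mean (fun s => ln (big_root (k - (2 + 2 * cos s)) (2 + 2 * cos s))) v ->
  mahler (FracField.tofrac (P_ k)) = v.
Proof.
move=> k8 hv; apply: mahler_polynomial.
suff H s : circle_mean (fun t => ln (cnorm (P_ k).[cis s, cis t]))
    (ln (big_root (k - (2 + 2 * cos s)) (2 + 2 * cos s))).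
  exact/(torus_mean_poly1 _ (fun s _ => H s)).
have /andP[D0 D4] := two_cos_bound s.
have := @circle_mean_ln_cnorm_harmonic (k - (2 + 2 * cos s)) (- (1 + cis s))
  (fun t => (P_ k).[cis s, cis t]).
rewrite cnormN cnorm_1Dcis; apply; first by lra.
  by nra.
move=> t; rewrite P_eval -[RHS](cnorm_cisM (s + t)) -[RHS]cnormN.
congr cnorm; rewrite cisD.
have -> : (k - (2 + 2 * cos s))%:C = k%:C - 2 - cis s - (cis s)^-1.
  rewrite -cis_conjV /cis; apply/eqP; rewrite eq_complex /=.
  by apply/andP; split; apply/eqP; ring.
have -> : conjc (- (1 + cis s)) = - (1 + (cis s)^-1).
  rewrite -cis_conjV /cis; apply/eqP; rewrite eq_complex /=.
  by apply/andP; split; apply/eqP; ring.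
move: (cis s) (cis t) (k%:C) (cis_neq0 s) (cis_neq0 t) => x y K x0 y0.
by field; rewrite x0 y0.
Qed.

(* [R_num] along [y = x / z], up to the factor [x y]. *)
Definition R_twist (k : R) : bipoly R :=
  'X ^+ 2 * 'Y + 'Y + 'X ^+ 2 + 'Y ^+ 2 + ((k - 4)%:C)%:P%:P * ('X * 'Y).

Lemma R_twist_eval k (x y : R[i]) :
  (R_twist k).[x, y] = x ^+ 2 * y + y + x ^+ 2 + y ^+ 2 + (k - 4)%:C * (x * y).
Proof.
have KE := eval2C (k - 4)%:C x y; have YE := eval2_Y x y; have XE := eval2_X x y.
rewrite /R_twist.
move: (((k - 4)%:C)%:P%:P : bipoly R) KE ('Y : bipoly R) YE ('X : bipoly R) XE
  => K KE Y YE X XE.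
rewrite !eval2D (eval2M (X ^+ 2)) !eval2_exp.
by rewrite !eval2M KE YE XE.
Qed.

Lemma R_numE (k s t : R) :
  cnorm (R_num k).[cis s, cis t] = `|(k - 4) + 2 * cos s + 2 * cos t|.
Proof.
rewrite R_num_eval -cnorm_real -[RHS](cnorm_cisM (s + t)).
congr cnorm; rewrite cisD.
have -> : (k - 4 + 2 * cos s + 2 * cos t)%:C =
   (k - 4)%:C + (cis s + (cis s)^-1) + (cis t + (cis t)^-1).
  rewrite -!cis_conjV /cis; apply/eqP; rewrite eq_complex /=.
  by apply/andP; split; apply/eqP; ring.
move: (cis s) (cis t) ((k - 4)%:C) (cis_neq0 s) (cis_neq0 t) => x y K x0 y0.
by field; rewrite x0 y0.
Qed.

Lemma R_twistE (k s t : R) :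
  cnorm (R_twist k).[cis s, cis t] = cnorm (R_num k).[cis s, cis (s - t)].
Proof.
rewrite R_num_eval R_twist_eval -[RHS](cnorm_cisM (t + t - s)).
congr cnorm; rewrite !cisD !cisN !cis_conjV.
move: (cis s) (cis t) ((k - 4)%:C) (cis_neq0 s) (cis_neq0 t) => x y K x0 y0.
by field; rewrite x0 y0.
Qed.

Lemma R_num_gt0 (k s t : R) : 4 < `|k - 4| -> 0 < cnorm (R_num k).[cis s, cis t].
Proof.
move=> k4; rewrite R_numE normr_gt0.
have := cos_le1 s; have := cos_geN1 s; have := cos_le1 t; have := cos_geN1 t.
by move: k4; rewrite ltr_normr => /orP[] ? ? ? ? ?; apply/eqP; lra.
Qed.

Lemma R_fraction (k : R) :
  R_ k * FracField.tofrac ('X * 'Y : bipoly R) = FracField.tofrac (R_num k).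
Proof.
have X0 : ('X : bipoly R) != 0 by rewrite polyX_eq0.
have Y0 : ('Y : bipoly R) != 0 by rewrite polyC_eq0 polyX_eq0.
have H := tofrac_clear_denominators ((k - 4)%:C)%:P%:P X0 Y0.
by rewrite /R_ /R_num; exact: H.
Qed.

(** The reflection [t -> s - t] keeps the mean in [t], and after it [R_k] becomes
    [(k - 4) + 2 Re (conj (1 + y) x)], whose mean in [x] is explicit. The hypothesis keeps [R_k]
    away from [0] on the torus. *)
Lemma mahler_R (k v : R) : 4 < `|k - 4| ->
  circle_mean (fun t => ln (big_root `|k - 4| (2 + 2 * cos t))) v ->
  mahler (R_ k) = v.
Proof.
move=> k4 hv.
have XY0 : ('X * 'Y : bipoly R) != 0.
  by rewrite mulf_neq0 ?polyX_eq0// polyC_eq0 polyX_eq0.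
apply: (@mahler_fraction _ _ (R_num k) ('X * 'Y)) => //.
- by move=> s t; rewrite eval2M eval2_X eval2_Y cnormM !cnorm_cis mulr1.
- exact: R_fraction.
have cont s : continuous (fun t => ln (cnorm (R_num k).[cis s, cis t])).
  apply: continuous_ln_cnorm; last by move=> t; rewrite -cnorm_gt0; exact: R_num_gt0.
  have -> : (fun t => (R_num k).[cis s, cis t]) = (fun t : R =>
     cis s + (cis s ^+ 2 + 1 + (k - 4)%:C * cis s) * cis t + cis s * (cis t * cis t)).
    by apply/funext => t; rewrite R_num_eval; ring.
  apply: complex_continuousD; first exact: complex_continuous_affine.
  apply: complex_continuousM; first exact: complex_continuous_cst.
  by apply: complex_continuousM; exact: complex_continuous_cis.
have per s t : ln (cnorm (R_num k).[cis s, cis (t + 2 * pi)]) =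
  ln (cnorm (R_num k).[cis s, cis t]) by rewrite cisD2pi.
pose g s := (2 * pi)^-1 * \int[lebesgue_measure]_(t in I) ln (cnorm (R_num k).[cis s, cis t]).
have gP s : circle_mean (fun t => ln (cnorm (R_num k).[cis s, cis t])) (g s).
  exact: circle_mean_continuous.
have gP' s : circle_mean (fun t => ln (cnorm (R_twist k).[cis s, cis t])) (g s).
  have := circle_mean_reflect (cont s) (per s) s (gP s).
  by apply: circle_mean_eq => t _; rewrite R_twistE.
apply/(torus_mean_poly1 _ (fun s _ => gP s)).
apply/(torus_mean_poly1 _ (fun s _ => gP' s)).
suff H t : circle_mean (fun s => ln (cnorm (R_twist k).[cis s, cis t]))
    (ln (big_root `|k - 4| (2 + 2 * cos t))).
  exact/(torus_mean_poly2 _ (fun t _ => H t)).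
(* Multiplying by the sign makes the constant term [|k - 4|] positive, so both ranges of [k] are
   treated at once. *)
pose sg : R := Num.sg (k - 4).
have k0 : k - 4 != 0 by apply/eqP => k0; move: k4; rewrite k0 normr0; lra.
have sg1 : sg * (k - 4) = `|k - 4| by rewrite -normrEsg.
have /andP[D0 D4] := two_cos_bound t.
have nsg : cnorm sg%:C = 1 by rewrite cnorm_real /sg normr_sg k0.
have nsgM z : cnorm (sg%:C * z) = cnorm z by rewrite cnormM nsg mul1r.
pose e := sg%:C * (1 + cis t).
have eE : cnorm e ^+ 2 = 2 + 2 * cos t by rewrite cnormM nsg mul1r cnorm_1Dcis.
rewrite -eE; apply: circle_mean_ln_cnorm_harmonic; first by lra.
  by rewrite eE; nra.
move=> s; rewrite R_twist_eval.
rewrite -[RHS](cnorm_cisM (s + t)) -[RHS](nsgM).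
congr cnorm; rewrite cisD.
have -> : conjc e = sg%:C * (1 + (cis t)^-1).
  rewrite -cis_conjV /e /cis; apply/eqP; rewrite eq_complex /=.
  by apply/andP; split; apply/eqP; ring.
have sg2 : sg%:C * sg%:C = 1 by rewrite -rmorphM -expr2 sqr_sg k0.
rewrite -sg1 rmorphM /e.
have -> : sg%:C * (cis s * cis t * (sg%:C * (k - 4)%:C + sg%:C * (1 + (cis t)^-1) * cis s
    + sg%:C * (1 + cis t) / cis s)) = (sg%:C * sg%:C) * (cis s * cis t *
    ((k - 4)%:C + (1 + (cis t)^-1) * cis s + (1 + cis t) / cis s)) by ring.
rewrite sg2 mul1r.
move: (cis s) (cis t) ((k - 4)%:C) (cis_neq0 s) (cis_neq0 t) => x y K x0 y0.
by field; rewrite x0 y0.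
Qed.

End RandP.

(** * The Landen transformation *)

Local Close Scope complex_scope.

Section Landen.
Context {R : realType}.
Local Notation mu := (@lebesgue_measure R).

Lemma continuousD_fun (f g : R -> R) : continuous f -> continuous g ->
  continuous (fun x => f x + g x).
Proof. by move=> cf cg x; apply: cvgD; [exact: cf|exact: cg]. Qed.

Lemma continuousB_fun (f g : R -> R) : continuous f -> continuous g ->
  continuous (fun x => f x - g x).
Proof. by move=> cf cg x; apply: cvgB; [exact: cf|exact: cg]. Qed.

Lemma continuousM_fun (f g : R -> R) : continuous f -> continuous g ->
  continuous (fun x => f x * g x).
Proof. by move=> cf cg x; apply: cvgM; [exact: cf|exact: cg]. Qed.

Lemma continuousX_fun (f : R -> R) n : continuous f -> continuous (fun x => f x ^+ n).
Proof.
move=> cf; elim: n => [|n IH].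
  by under eq_fun do rewrite expr0; move=> x; exact: cvg_cst.
by under eq_fun do rewrite exprS; exact: continuousM_fun.
Qed.

Lemma continuousV_fun (f : R -> R) : continuous f -> (forall x, f x != 0) ->
  continuous (fun x => (f x)^-1).
Proof. by move=> cf f0 x; apply: cvgV => //; exact: cf. Qed.

Lemma continuous_cst_fun (a : R) : continuous (fun _ : R => a).
Proof. by move=> x; exact: cvg_cst. Qed.

Lemma continuous_sqrt_fun (f : R -> R) : continuous f ->
  continuous (fun x => Num.sqrt (f x)).
Proof.
move=> cf x; apply: (@continuous_comp _ _ _ f (@Num.sqrt R)); first exact: cf.
exact: sqrt_continuous.
Qed.

Lemma continuous_ln_fun (f : R -> R) : continuous f -> (forall x, 0 < f x) ->
  continuous (fun x => ln (f x)).
Proof.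
move=> cf f0 x; apply: (@continuous_comp _ _ _ f (@ln R)); first exact: cf.
exact: continuous_ln.
Qed.

Lemma continuous_big_root (f g : R -> R) : continuous f -> continuous g ->
  continuous (fun x => big_root (f x) (g x)).
Proof.
move=> cf cg; rewrite /big_root.
apply: continuousM_fun; last exact: continuous_cst_fun.
apply: continuousD_fun => //; apply: continuous_sqrt_fun.
apply: continuousB_fun; first exact: continuousX_fun.
by apply: continuousM_fun => //; exact: continuous_cst_fun.
Qed.

(** Continuity of [asin] within [[-1, 1]], as an inverse of [sin], suffices because [b] never leaves
    this interval; points with [b s = 1] or [-1] are included. *)
Lemma asin_comp_continuous (b : R -> R) : continuous b ->
  (forall s, -1 <= b s <= 1) -> continuous (fun s => asin (b s)).
Proof.
move=> cb b1 s.
have pp : - (pi / 2) <= pi / 2 :> R by have := @pi_gt0 R; lra.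
have := @segment_can_le_continuous R (- (pi / 2)) (pi / 2) sin asin pp
  (continuous_subspaceT (@continuous_sin R)) (@sinK R).
rewrite sinN sin_pihalf => /subspace_continuousP /(_ (b s)).
rewrite /= in_itv/= => /(_ (b1 s)) H.
apply: cvg_comp H => U [e e0 eU].
have nU : nbhs s (b @^-1` ball (b s) e) by apply: cb; exact: nbhsx_ballx.
suff : nbhs s (b @^-1` U) by [].
apply: filterS nU => t /= bt; apply: eU => //=.
by rewrite in_itv/=; exact: b1.
Qed.

Local Notation der f x d := (is_derive x (1 : R) f d).

Lemma der_eq (f : R -> R) (x a b : R) : der f x a -> a = b -> der f x b.
Proof. by move=> fa <-. Qed.

Lemma der_ext (f g : R -> R) (x a : R) : der f x a -> f =1 g -> der g x a.
Proof. by move=> fa /funext <-. Qed.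

Lemma der_cst (c x : R) : der (fun=> c) x 0.
Proof. exact: is_derive_cst. Qed.

Lemma derD (f g : R -> R) (x a b : R) : der f x a -> der g x b ->
  der (fun y => f y + g y) x (a + b).
Proof. by move=> fa gb; exact: is_deriveD. Qed.

Lemma derB (f g : R -> R) (x a b : R) : der f x a -> der g x b ->
  der (fun y => f y - g y) x (a - b).
Proof. by move=> fa gb; exact: is_deriveB. Qed.

Lemma derM (f g : R -> R) (x a b : R) : der f x a -> der g x b ->
  der (fun y => f y * g y) x (f x * b + g x * a).
Proof. by move=> fa gb; exact: is_deriveM. Qed.

Lemma derX (f : R -> R) n (x a : R) : der f x a ->
  der (fun y => f y ^+ n) x (n%:R * f x ^+ n.-1 * a).
Proof.
move=> fa; apply: (der_ext (is_deriveX n fa)) => y.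
by elim: n => [|n IH]; rewrite ?expr0// !exprS -IH.
Qed.

Lemma derZ (f : R -> R) (c x a : R) : der f x a -> der (fun y => c * f y) x (c * a).
Proof. by move=> fa; exact: is_deriveZ. Qed.

Lemma derV (f : R -> R) (x a : R) : f x != 0 -> der f x a ->
  der (fun y => (f y)^-1) x (- a / f x ^+ 2).
Proof.
move=> f0 fa; apply: (der_eq (is_deriveV f0 fa)).
by rewrite -[LHS]/(- (f x ^- 2) * a) mulNr mulNr mulrC.
Qed.

Lemma der_comp (f g : R -> R) (x a b : R) : der f (g x) a -> der g x b ->
  der (fun y => f (g y)) x (a * b).
Proof. by move=> fa gb; exact: is_derive1_comp. Qed.

Lemma der_sqrt (f : R -> R) (x a : R) : 0 < f x -> der f x a ->
  der (fun y => Num.sqrt (f y)) x (a / (2 * Num.sqrt (f x))).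
Proof.
move=> f0 fa; have h := is_derive1_sqrt f0.
by apply: (der_eq (der_comp h fa)); rewrite mulrC.
Qed.

Lemma der_ln (f : R -> R) (x a : R) : 0 < f x -> der f x a ->
  der (fun y => ln (f y)) x (a / f x).
Proof.
move=> f0 fa; have h := is_derive1_ln f0.
by apply: (der_eq (der_comp h fa)); rewrite mulrC.
Qed.

Lemma der_big_root (f : R -> R) (c x a : R) : 4 * c < f x ^+ 2 -> der f x a ->
  der (fun y => big_root (f y) c) x
    (a * big_root (f x) c / Num.sqrt (f x ^+ 2 - 4 * c)).
Proof.
move=> cf fa; rewrite -subr_gt0 in cf.
have r0 : 0 < Num.sqrt (f x ^+ 2 - 4 * c) by rewrite sqrtr_gt0.
have h1 := derB (derX 2 fa) (der_cst (4 * c) x).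
have h2 := derM (derD fa (@der_sqrt (fun y => f y ^+ 2 - 4 * c) _ _ cf h1))
    (der_cst 2^-1 x).
apply: (der_eq h2); rewrite /big_root /= expr1; field.
by rewrite gt_eqF.
Qed.

Variable k : R.
Hypothesis k8 : 8 < k.

Let D (s : R) := 2 + 2 * cos s.
Let E s := k - D s.
Let G s := E s ^+ 2 - 4 * D s.

(* The substitution [sin chi = landen s] maps [[0, pi]] onto
   [[- pi / 2, pi / 2]]; it is Gauss's (Landen's) quadratic transformation. *)
Definition landen (s : R) : R :=
  (D s ^+ 2 - k * D s + 2 * k) / (2 * (k - 2 * D s)).

(** As [4 cos^2 chi = 2 + 2 cos (2 chi)], this is the larger root [T] at the angle [t = 2 chi]. *)
Definition J_root (chi : R) := big_root (k - 4) (4 * cos chi ^+ 2).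
Definition J_disc (chi : R) := Num.sqrt ((k - 4) ^+ 2 - 4 * (4 * cos chi ^+ 2)).

Definition J_derivative (chi : R) :=
  J_root chi / (J_disc chi * Num.sqrt (J_root chi ^+ 2 + 4 * J_root chi)).

Let D04 s : 0 <= D s <= 4.
Proof. exact: two_cos_bound. Qed.

Let kD s : 0 < k - 2 * D s.
Proof. have /andP[] := D04 s; move: (D s) => d ? ?; have := k8; lra. Qed.

Let E0 s : 4 < E s.
Proof. have /andP[] := D04 s; rewrite /E; move: (D s) => d ? ?; have := k8; lra. Qed.

Let G0 s : 0 < G s.
Proof.
have /andP[] := D04 s; have := E0 s; rewrite /G; move: (E s) (D s) => e d; nra.
Qed.

Lemma one_sub_landen_sqr s :
  1 - landen s ^+ 2 = E s * (E s - 4) * sin s ^+ 2 / (k - 2 * D s) ^+ 2.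
Proof.
have -> : sin s ^+ 2 = D s * (4 - D s) / 4 by rewrite sin2cos2 /D; field.
have := kD s; rewrite /landen /E; move: (D s) => d d0.
by field; rewrite gt_eqF.
Qed.

Lemma landen_bound s : -1 <= landen s <= 1.
Proof.
have : 0 <= 1 - landen s ^+ 2.
  rewrite one_sub_landen_sqr divr_ge0 ?sqr_ge0// mulr_ge0 ?sqr_ge0// mulr_ge0//.
    by have := E0 s; lra.
  by have := E0 s; lra.
by move: (landen s) => x ?; apply/andP; split; nra.
Qed.

(** Occurs both in the derivative of [landen] and in the transformed [J_disc], where the two copies
    cancel. *)
Let W s := k ^+ 2 - 2 * k * D s + 2 * D s ^+ 2 - 4 * k.

Let W0 s : 0 < W s.
Proof.
have /andP[] := D04 s; rewrite /W; move: (D s) => d d0 d4; have := k8 => k8'.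
have -> : k ^+ 2 - 2 * k * d + 2 * d ^+ 2 - 4 * k =
  (k - 4) * (k - 8) + (4 - d) * (2 * k - 2 * d - 8) by ring.
have : 0 < (k - 4) * (k - 8) by rewrite mulr_gt0// subr_gt0; lra.
have : 0 <= (4 - d) * (2 * k - 2 * d - 8) by rewrite mulr_ge0//; lra.
by lra.
Qed.

Let sinD s : sin s ^+ 2 = D s * (4 - D s) / 4.
Proof. by rewrite sin2cos2 /D; field. Qed.

Let cos_asin_landen s : cos (asin (landen s)) ^+ 2 = 1 - landen s ^+ 2.
Proof. by rewrite cos2sin2 asinK// in_itv/= landen_bound. Qed.

(** The point of the substitution: the discriminant becomes a perfect square, and hence [J_root]
    becomes rational in [cos s]. *)
Lemma J_disc_landen s : J_disc (asin (landen s)) = W s / (k - 2 * D s).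
Proof.
rewrite /J_disc cos_asin_landen one_sub_landen_sqr sinD.
have -> : (k - 4) ^+ 2 - 4 * (4 * (E s * (E s - 4) * (D s * (4 - D s) / 4) /
    (k - 2 * D s) ^+ 2)) = (W s / (k - 2 * D s)) ^+ 2.
  rewrite /W /E; have := kD s; move: (D s) => d d0.
  by field; rewrite gt_eqF.
by rewrite sqrtr_sqr ger0_norm// divr_ge0 ?ltW ?W0.
Qed.

Lemma J_root_landen s : J_root (asin (landen s)) = E s * (E s - 4) / (k - 2 * D s).
Proof.
have := J_disc_landen s; rewrite /J_root /J_disc /big_root => ->.
rewrite /W /E; have := kD s; move: (D s) => d d0.
by field; rewrite gt_eqF.
Qed.

Let dD s : der D s (- (2 * sin s)).
Proof.
have h := derD (der_cst 2 s) (derZ 2 (is_derive_cos s)).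
by apply: (der_eq h); rewrite add0r mulrN.
Qed.

Lemma landen_derive s : der landen s (sin s * W s / (k - 2 * D s) ^+ 2).
Proof.
have h1 := derD (derB (derX 2 (dD s)) (derZ k (dD s))) (der_cst (2 * k) s).
have h2 := derZ 2 (derB (der_cst k s) (derZ 2 (dD s))).
have d0 : 2 * (k - 2 * D s) != 0 by rewrite mulf_neq0// gt_eqF.
apply: (der_eq (derM h1 (@derV (fun s => 2 * (k - 2 * D s)) _ _ d0 h2))).
rewrite /= expr1 /W; have := kD s; move: (D s) => d d1.
by field; rewrite gt_eqF.
Qed.

(** The factor [sin s] of the derivative of [landen] cancels against the one in the square root of
    [1 - landen s ^+ 2]. *)
Lemma asin_landen_derive s : 0 < s < pi ->
  der (fun t => asin (landen t)) s
    (W s / ((k - 2 * D s) * Num.sqrt (E s * (E s - 4)))).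
Proof.
move=> sp; have s0 : 0 < sin s by exact: sin_gt0_pi.
have ee : 0 < E s * (E s - 4) by have := E0 s; move: (E s) => e e0; nra.
have := one_sub_landen_sqr s.
have -> : E s * (E s - 4) * sin s ^+ 2 / (k - 2 * D s) ^+ 2 =
  (Num.sqrt (E s * (E s - 4)) * sin s / (k - 2 * D s)) ^+ 2.
  by rewrite !exprMn sqr_sqrtr ?ltW// exprVn.
have r0 : 0 < Num.sqrt (E s * (E s - 4)) by rewrite sqrtr_gt0.
have q0 : 0 < Num.sqrt (E s * (E s - 4)) * sin s / (k - 2 * D s).
  by rewrite divr_gt0 ?mulr_gt0.
move=> lE.
have l1 : -1 < landen s < 1.
  have : 0 < 1 - landen s ^+ 2 by rewrite lE exprn_gt0.
  by move: (landen s) => x ?; apply/andP; split; nra.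
apply: (der_eq (@der_comp asin landen _ _ _ (is_derive1_asin l1) (landen_derive s))).
rewrite lE sqrtr_sqr gtr0_norm//.
have := kD s => kd; field.
by rewrite !gt_eqF.
Qed.

Let J_rootE chi : 2 < J_root chi.
Proof.
apply: lt_le_trans (big_root_ge _ _); have := k8; lra.
Qed.

Let J_disc0 chi : 0 < (k - 4) ^+ 2 - 4 * (4 * cos chi ^+ 2).
Proof.
have : cos chi ^+ 2 <= 1.
  by have := cos_le1 chi; have := cos_geN1 chi; move: (cos chi) => c ? ?; nra.
have : 16 < (k - 4) ^+ 2 by have := k8 => ?; nra.
by lra.
Qed.

Lemma continuous_J_root : continuous J_root.
Proof.
apply: continuous_big_root; first exact: continuous_cst_fun.
apply: continuousM_fun; first exact: continuous_cst_fun.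
by apply: continuousX_fun; exact: continuous_cos.
Qed.

Lemma continuous_J_derivative : continuous J_derivative.
Proof.
have cJ := continuous_J_root; rewrite /J_derivative.
apply: continuousM_fun => //; apply: continuousV_fun.
  apply: continuousM_fun; apply: continuous_sqrt_fun.
    apply: continuousB_fun; first exact: continuous_cst_fun.
    apply: continuousM_fun; first exact: continuous_cst_fun.
    apply: continuousM_fun; first exact: continuous_cst_fun.
    by apply: continuousX_fun; exact: continuous_cos.
  apply: continuousD_fun; first exact: continuousX_fun.
  by apply: continuousM_fun => //; exact: continuous_cst_fun.
move=> chi; rewrite mulf_neq0// gt_eqF// sqrtr_gt0; first exact: J_disc0.
by have := J_rootE chi; move: (J_root chi) => T ?; nra.
Qed.

Let cD : continuous D.
Proof.
apply: continuousD_fun; first exact: continuous_cst_fun.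
by apply: continuousM_fun; [exact: continuous_cst_fun|exact: continuous_cos].
Qed.

Let cE : continuous E.
Proof. by apply: continuousB_fun => //; exact: continuous_cst_fun. Qed.

Lemma continuous_landen : continuous landen.
Proof.
apply: continuousM_fun.
  apply: continuousD_fun; last exact: continuous_cst_fun.
  apply: continuousB_fun; first exact: continuousX_fun.
  by apply: continuousM_fun => //; exact: continuous_cst_fun.
apply: continuousV_fun.
  apply: continuousM_fun; first exact: continuous_cst_fun.
  apply: continuousB_fun; first exact: continuous_cst_fun.
  by apply: continuousM_fun => //; exact: continuous_cst_fun.
by move=> s; rewrite mulf_neq0// gt_eqF.
Qed.

Lemma continuous_P_derivative : continuous (fun s => (Num.sqrt (G s))^-1).
Proof.
apply: continuousV_fun; last by move=> s; rewrite gt_eqF// sqrtr_gt0.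
apply: continuous_sqrt_fun; apply: continuousB_fun; first exact: continuousX_fun.
by apply: continuousM_fun => //; exact: continuous_cst_fun.
Qed.

(** With [T = E (E - 4) / (k - 2 D)] one has [T^2 + 4 T = E (E - 4) G / (k - 2 D)^2]. After [W]
    cancels, the factors [E (E - 4)] and [k - 2 D] cancel as well, leaving [1 / sqrt G]. *)
Lemma landen_transformation :
  \int[mu]_(s in `[0, pi]) (Num.sqrt (G s))^-1 =
  \int[mu]_(chi in `[- (pi / 2), pi / 2]) J_derivative chi.
Proof.
have pi0 := @pi_gt0 R.
have [F dF] := primitive_exists (- pi) continuous_J_derivative.
have pp : - (pi / 2) <= pi / 2 :> R by lra.
have dF' x : - (pi / 2) <= x <= pi / 2 -> der F x (J_derivative x).
  by move=> /andP[x0 _]; apply: dF; lra.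
rewrite (derive_integral_continuous pp continuous_J_derivative dF').
have l0 : landen 0 = -1.
  rewrite /landen /D cos0; field; have := k8 => ?; apply/eqP; lra.
have lpi : landen pi = 1.
  rewrite /landen /D cospi; field; have := k8 => ?; apply/eqP; lra.
have asin1 : asin 1 = pi / 2 :> R.
  by have := @sinK R (pi / 2); rewrite sin_pihalf; apply; rewrite in_itv/= lexx andbT.
have asinN1 : asin (-1) = - (pi / 2) :> R.
  by have := @sinK R (- (pi / 2)); rewrite sinN sin_pihalf; apply; rewrite in_itv/= lexx.
have ca := asin_comp_continuous continuous_landen landen_bound.
have dG s : 0 < s < pi -> der (fun t => F (asin (landen t))) s (Num.sqrt (G s))^-1.
  move=> sp.
  have al : - pi < asin (landen s).
    by have := asin_geNpi2 (landen_bound s); lra.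
  have h := @der_comp F (fun s => asin (landen s)) _ _ _ (dF _ al) (asin_landen_derive sp).
  apply: (der_eq h); rewrite /J_derivative J_disc_landen J_root_landen.
  have ee : 0 < E s * (E s - 4) by have := E0 s; move: (E s) => e e0; nra.
  have kd := kD s.
  have -> : (E s * (E s - 4) / (k - 2 * D s)) ^+ 2 +
      4 * (E s * (E s - 4) / (k - 2 * D s)) =
      (Num.sqrt (E s * (E s - 4)) * Num.sqrt (G s) / (k - 2 * D s)) ^+ 2.
    rewrite !exprMn !sqr_sqrtr ?ltW// exprVn /G /E.
    by field; rewrite gt_eqF.
  have r0 : 0 < Num.sqrt (E s * (E s - 4)) by rewrite sqrtr_gt0.
  have g0 : 0 < Num.sqrt (G s) by rewrite sqrtr_gt0.
  rewrite sqrtr_sqr ger0_norm ?divr_ge0 ?mulr_ge0 ?ltW//.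
  have -> : E s * (E s - 4) / (k - 2 * D s) =
    Num.sqrt (E s * (E s - 4)) ^+ 2 / (k - 2 * D s) by rewrite sqr_sqrtr ?ltW.
  have w0 := W0 s.
  move: (Num.sqrt (G s)) (Num.sqrt (E s * _)) (k - 2 * D s) (W s) g0 r0 kd w0.
  by move=> g r d w g0 r0 d0 w0; field; rewrite !gt_eqF.
have cF : continuous (fun s => F (asin (landen s))).
  move=> s.
  apply: (@continuous_comp _ _ _ (fun s => asin (landen s)) F); first exact: ca.
  have al : - pi < asin (landen s).
    by have := asin_geNpi2 (landen_bound s); lra.
  exact: is_derive_cvg (dF _ al).
rewrite (derive_integral (ltW pi0) (continuous_subspaceT continuous_P_derivative) dG
  (continuous_subspaceT cF)).
by rewrite l0 lpi asin1 asinN1.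
Qed.

End Landen.

(** * From the derivatives in [k] back to the logarithms *)

Section LandenLog.
Context {R : realType}.
Local Notation mu := (@lebesgue_measure R).
Local Notation der f x d := (is_derive x (1 : R) f d).

Lemma derive_under_integral (f df : R -> R -> R) (a b u v M x : R) : u < x < v ->
  (forall x, u < x < v -> continuous (f x)) ->
  (forall x y, u < x < v -> der (f ^~ y) x (df x y)) ->
  (forall x y, u < x < v -> `|df x y| <= M) ->
  der (fun x => \int[mu]_(y in `[a, b]) f x y) x (\int[mu]_(y in `[a, b]) df x y).
Proof.
move=> xuv cf dfP dfM.
have M0 : 0 <= M := le_trans (normr_ge0 _) (dfM x 0 xuv).
have xI : `]u, v[%classic x by rewrite /= in_itv.
have int_f z : `]u, v[%classic z -> mu.-integrable `[a, b] (EFin \o f z).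
  by rewrite /= in_itv/= => zuv; apply: continuous_integrable; exact: cf.
have der_f z y : `]u, v[%classic z -> `[a, b]%classic y -> derivable (f ^~ y) z 1.
  by rewrite /= in_itv/= => zuv _; have [] := dfP z y zuv.
have dE z y : u < z < v -> partial1of2 f z y = df z y.
  by move=> zuv; have [_ E] := dfP z y zuv; rewrite partial1of2E.
have int_M : mu.-integrable `[a, b] (EFin \o cst M).
  by apply: continuous_integrable; exact: continuous_cst_fun.
have ub z y : `]u, v[%classic z -> `[a, b]%classic y -> `|partial1of2 f z y| <= cst M y.
  by rewrite /= in_itv/= => zuv _; rewrite dE//; exact: dfM.
have h1 := @derivable_under_integral R _ _ mu f `[a, b] (measurable_itv _) x u v xI int_f
  der_f (cst M) (fun=> M0) int_M ub.
have h2 := @differentiation_under_integral R _ _ mu f `[a, b] (measurable_itv _) x u v xI int_f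
  der_f (cst M) (fun=> M0) int_M ub.
apply: DeriveDef; first exact: h1.
rewrite -derive1E h2; apply: eq_Rintegral => y _; exact: dE.
Qed.

Definition P_log (k s : R) := ln (big_root (k - (2 + 2 * cos s)) (2 + 2 * cos s)).

(** The logarithm of the larger root of [u^2 - (T + 2) u + 1], and the [J] for which the inner mean
    of [Qscaled] is [(ln T + J) / 2] when [17 <= k]. *)
Definition J_log (k chi : R) := let T := J_root k chi in
  ln ((T + 2 + Num.sqrt (T ^+ 2 + 4 * T)) / 2).

Lemma big_root_bounds (A c : R) : 0 <= c <= 4 -> 4 <= A ->
  A - 2 <= big_root A c <= A.
Proof.
move=> /andP[c0 c4] A4.
have A0 : 0 <= A - 4 by lra.
have h0 : 0 <= A ^+ 2 - 4 * c by nra.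
have h1 : A - 4 <= Num.sqrt (A ^+ 2 - 4 * c).
  by rewrite -(@ler_pXn2r _ 2%N) ?nnegrE ?sqrtr_ge0// sqr_sqrtr//; nra.
have h2 : Num.sqrt (A ^+ 2 - 4 * c) <= A.
  by rewrite -(@ler_pXn2r _ 2%N) ?nnegrE ?sqrtr_ge0//; [rewrite sqr_sqrtr//; nra|lra].
by rewrite /big_root; apply/andP; split; lra.
Qed.

Lemma four_cos_sqr_bound (chi : R) : 0 <= 4 * cos chi ^+ 2 <= 4.
Proof.
have := cos_le1 chi; have := cos_geN1 chi; move: (cos chi) => c ? ?.
by apply/andP; split; nra.
Qed.

Lemma sqrt_add4_bounds (T : R) : 0 <= T -> T <= Num.sqrt (T ^+ 2 + 4 * T) <= T + 2.
Proof.
move=> T0; have h : 0 <= T ^+ 2 + 4 * T by nra.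
apply/andP; split; rewrite -(@ler_pXn2r _ 2%N) ?nnegrE ?sqrtr_ge0// ?sqr_sqrtr//.
- by nra.
- by lra.
- by nra.
Qed.

Lemma continuous_P_log (k : R) : 8 < k -> continuous (P_log k).
Proof.
move=> k8.
have cD : continuous (fun s : R => 2 + 2 * cos s).
  apply: continuousD_fun; first exact: continuous_cst_fun.
  by apply: continuousM_fun; [exact: continuous_cst_fun|exact: continuous_cos].
apply: continuous_ln_fun.
  apply: continuous_big_root => //.
  by apply: continuousB_fun => //; exact: continuous_cst_fun.
move=> s; apply: lt_le_trans (big_root_ge _ _).
by have /andP[] := two_cos_bound s; lra.
Qed.

Lemma J_root_gt2 (k chi : R) : 8 < k -> 2 < J_root k chi.
Proof. by move=> k8; apply: lt_le_trans (big_root_ge _ _); lra. Qed.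

Lemma continuous_J_log (k : R) : 8 < k -> continuous (J_log k).
Proof.
move=> k8; have cJ := @continuous_J_root R k; rewrite /J_log.
apply: continuous_ln_fun.
  apply: continuousM_fun; last exact: continuous_cst_fun.
  apply: continuousD_fun.
    by apply: continuousD_fun => //; exact: continuous_cst_fun.
  apply: continuous_sqrt_fun; apply: continuousD_fun; first exact: continuousX_fun.
  by apply: continuousM_fun => //; exact: continuous_cst_fun.
move=> chi; have := J_root_gt2 chi k8; move: (J_root _ _) => T T2.
by have := sqrtr_ge0 (T ^+ 2 + 4 * T); lra.
Qed.

Lemma P_log_derive (k s : R) : 8 < k ->
  der (P_log ^~ s) k (Num.sqrt ((k - (2 + 2 * cos s)) ^+ 2 - 4 * (2 + 2 * cos s)))^-1.
Proof.
move=> k8; have /andP[] := two_cos_bound s; rewrite /P_log.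
move: (2 + 2 * cos s) => D D0 D4.
have h1 : der (fun k => k - D) k (1 - 0).
  exact: derB (is_derive_id _ _) (der_cst D k).
have cA : 4 * D < (k - D) ^+ 2 by nra.
have h2 := @der_big_root _ (fun k => k - D) D k _ cA h1.
have r0 : 0 < big_root (k - D) D.
  by apply: lt_le_trans (big_root_ge _ _); lra.
apply: (der_eq (@der_ln _ (fun k => big_root (k - D) D) _ _ r0 h2)).
have q0 : 0 < Num.sqrt ((k - D) ^+ 2 - 4 * D) by rewrite sqrtr_gt0 subr_gt0.
by rewrite subr0; field; rewrite !gt_eqF.
Qed.

Lemma J_log_derive (k chi : R) : 8 < k -> der (J_log ^~ chi) k (J_derivative k chi).
Proof.
move=> k8; have /andP[] := four_cos_sqr_bound chi.
have := J_root_gt2 chi k8.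
rewrite /J_log /J_derivative /J_disc /J_root.
move: (4 * cos chi ^+ 2) => c T2 c0 c4.
have h1 : der (fun k => k - 4) k (1 - 0).
  exact: derB (is_derive_id _ _) (der_cst 4 k).
have cA : 4 * c < (k - 4) ^+ 2 by nra.
have h2 := @der_big_root _ (fun k => k - 4) c k _ cA h1.
set T := big_root (k - 4) c in T2 h2 *.
have T4 : 0 < T ^+ 2 + 4 * T by nra.
have h3 := @der_sqrt _ (fun k => big_root (k - 4) c ^+ 2 + 4 * big_root (k - 4) c) _ _ T4
  (derD (derX 2 h2) (derZ 4 h2)).
have h4 := derM (derD (derD h2 (der_cst 2 k)) h3) (der_cst 2^-1 k).
have q0 : 0 < Num.sqrt (T ^+ 2 + 4 * T) by rewrite sqrtr_gt0.
have w0 : 0 < (T + 2 + Num.sqrt (T ^+ 2 + 4 * T)) / 2 by rewrite divr_gt0//; lra.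
apply: (der_eq (@der_ln _ (fun k => (big_root (k - 4) c + 2 +
  Num.sqrt (big_root (k - 4) c ^+ 2 + 4 * big_root (k - 4) c)) / 2) _ _ w0 h4)).
rewrite -/T; have p0 : 0 < Num.sqrt ((k - 4) ^+ 2 - 4 * c) by rewrite sqrtr_gt0 subr_gt0.
move: (Num.sqrt ((k - 4) ^+ 2 - 4 * c)) (Num.sqrt (T ^+ 2 + 4 * T)) p0 q0 w0 => p q p0 q0 w0.
rewrite /= expr1 subr0; field.
by rewrite !gt_eqF//; lra.
Qed.

(** One dominating constant for both derivatives in [k]: each is a number in [[0, 1]] over the
    square root of a discriminant. *)
Lemma sqrtV_bound (u x y : R) : 4 < u -> (u ^+ 2 - 16) <= x ->
  0 <= y <= 1 -> `|y / Num.sqrt x| <= (Num.sqrt (u ^+ 2 - 16))^-1.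
Proof.
move=> u4 ux /andP[y0 y1].
have u0 : 0 < u ^+ 2 - 16 by nra.
have s0 : 0 < Num.sqrt (u ^+ 2 - 16) by rewrite sqrtr_gt0.
have sx : Num.sqrt (u ^+ 2 - 16) <= Num.sqrt x by rewrite ler_wsqrtr.
have x0 : 0 < Num.sqrt x := lt_le_trans s0 sx.
rewrite ger0_norm ?divr_ge0// ?(ltW x0)//.
apply: (@le_trans _ _ (Num.sqrt x)^-1).
  by rewrite ler_piMl// invr_ge0 ltW.
by rewrite lef_pV2 ?posrE.
Qed.

Let P_int (k : R) := \int[mu]_(s in `[0, pi]) P_log k s.
Let J_int (k : R) := \int[mu]_(chi in `[- (pi / 2), pi / 2]) J_log k chi.

Let P_int_derive (k : R) : 8 < k ->
  der P_int k (\int[mu]_(chi in `[- (pi / 2), pi / 2]) J_derivative k chi).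
Proof.
move=> k8; rewrite -landen_transformation//.
(* The midpoint of [8] and [k]: parameters above it stay away from [8], and [4 < u - 4] keeps the
   dominating constant finite. *)
pose u := (k + 8) / 2.
apply: (@derive_under_integral P_log (fun k s =>
  (Num.sqrt ((k - (2 + 2 * cos s)) ^+ 2 - 4 * (2 + 2 * cos s)))^-1) 0 pi u (k + 1)
  (Num.sqrt ((u - 4) ^+ 2 - 16))^-1).
- by rewrite /u; apply/andP; split; lra.
- by move=> x /andP[ux _]; apply: continuous_P_log; rewrite /u in ux; lra.
- by move=> x y /andP[ux _]; apply: P_log_derive; rewrite /u in ux; lra.
- move=> x y /andP[ux _]; rewrite -[_^-1]mul1r; apply: sqrtV_bound.
  + by rewrite /u; lra.
  + have /andP[] := two_cos_bound y; move: (2 + 2 * cos y) => D D0 D4.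
    have u4 : 4 < u - 4 by rewrite /u; lra.
    have h : u - 4 <= x - D by lra.
    have : (u - 4) ^+ 2 <= (x - D) ^+ 2 by rewrite ler_pXn2r ?nnegrE//; lra.
    by lra.
  + by rewrite ler01 lexx.
Qed.

Let J_int_derive (k : R) : 8 < k ->
  der J_int k (\int[mu]_(chi in `[- (pi / 2), pi / 2]) J_derivative k chi).
Proof.
move=> k8.
pose u := (k + 8) / 2.
apply: (@derive_under_integral J_log J_derivative _ _ u (k + 1)
  (Num.sqrt ((u - 4) ^+ 2 - 16))^-1).
- by rewrite /u; apply/andP; split; lra.
- by move=> x /andP[ux _]; apply: continuous_J_log; rewrite /u in ux; lra.
- by move=> x y /andP[ux _]; apply: J_log_derive; rewrite /u in ux; lra.
- move=> x y /andP[ux _].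
  have x8 : 8 < x by rewrite /u in ux; lra.
  have := J_root_gt2 y x8; rewrite /J_derivative; move: (J_root x y) => T T2.
  have /andP[TT _] := sqrt_add4_bounds (ltW (lt_trans (@ltr0n R 2) T2)).
  have -> : T / (J_disc x y * Num.sqrt (T ^+ 2 + 4 * T)) =
     (T / Num.sqrt (T ^+ 2 + 4 * T)) / J_disc x y.
    by rewrite invfM mulrA mulrAC.
  apply: sqrtV_bound.
  + by rewrite /u; lra.
  + have /andP[] := four_cos_sqr_bound y; move: (4 * cos y ^+ 2) => c c0 c4.
    have u4 : 4 < u - 4 by rewrite /u; lra.
    have h : u - 4 <= x - 4 by lra.
    have : (u - 4) ^+ 2 <= (x - 4) ^+ 2 by rewrite ler_pXn2r ?nnegrE//; lra.
    by lra.
  + apply/andP; split; first by rewrite divr_ge0 ?sqrtr_ge0//; lra.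
    by rewrite ler_pdivrMr ?mul1r//; lra.
Qed.

Let integral_bounds (f : R -> R) (a b m M : R) : a <= b -> continuous f ->
  (forall x, m <= f x <= M) ->
  m * (b - a) <= \int[mu]_(x in `[a, b]) f x <= M * (b - a).
Proof.
move=> ab cf fb.
have mE c : \int[mu]_(x in `[a, b]) cst c x = c * (b - a).
  rewrite Rintegral_cst//= lebesgue_measure_itv/= lte_fin.
  have [->|nab] := eqVneq a b; first by rewrite ltxx subrr mulr0.
  by rewrite lt_neqAle nab ab.
rewrite -!mE; apply/andP; split; apply: le_Rintegral => //.
- by apply: continuous_integrable; exact: continuous_cst_fun.
- exact: continuous_integrable.
- by move=> x _; have /andP[] := fb x.
- exact: continuous_integrable.
- by apply: continuous_integrable; exact: continuous_cst_fun.
- by move=> x _; have /andP[] := fb x.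
Qed.

Lemma P_log_bounds (k s : R) : 8 < k -> ln (k - 6) <= P_log k s <= ln k.
Proof.
move=> k8; have Db := two_cos_bound s; have /andP[D0 D4] := Db.
have h : 4 <= k - (2 + 2 * cos s) by lra.
have /andP[b1 b2] := big_root_bounds Db h.
by rewrite /P_log; apply/andP; split; rewrite ler_ln ?posrE; lra.
Qed.

Lemma J_log_bounds (k chi : R) : 8 < k -> ln (k - 6) <= J_log k chi <= ln k.
Proof.
move=> k8; have cb := four_cos_sqr_bound chi.
have h : 4 <= k - 4 by lra.
have := big_root_bounds cb h; rewrite /J_log -/(J_root k chi).
move: (J_root k chi) => T /andP[b1 b2].
have T0 : 0 <= T by lra.
have /andP[s1 s2] := sqrt_add4_bounds T0.
by apply/andP; split; rewrite ler_ln ?posrE; lra.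
Qed.

(* Both integrals have the same derivative, and both are
   [pi * ln k + o(1)] at infinity. *)
Lemma landen_log (k : R) : 8 < k ->
  \int[mu]_(s in `[0, pi]) P_log k s =
  \int[mu]_(chi in `[- (pi / 2), pi / 2]) J_log k chi.
Proof.
move=> k8; rewrite -/(P_int k) -/(J_int k).
have pi0 := @pi_gt0 R.
pose h x := P_int x - J_int x.
have hK K : k <= K -> h k = h K.
  move=> kK; apply: derive0_eq kK _ => x /andP[kx _].
  have x8 : 8 < x := lt_le_trans k8 kx.
  by apply: (der_eq (derB (P_int_derive x8) (J_int_derive x8))); rewrite subrr.
have hb K : 8 < K -> `|h K| <= 6 * pi / (K - 6).
  move=> K8.
  have pi1 : 0 <= pi :> R by lra.
  have pi2 : - (pi / 2) <= pi / 2 :> R by lra.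
  have := integral_bounds pi1 (continuous_P_log K8) (fun s => P_log_bounds s K8).
  have := integral_bounds pi2 (continuous_J_log K8) (fun s => J_log_bounds s K8).
  rewrite -/(P_int K) -/(J_int K) subr0.
  have -> : pi / 2 - - (pi / 2) = pi :> R by field.
  have K6 : 0 < K - 6 by lra.
  have lnK : ln K - ln (K - 6) <= 6 / (K - 6).
    rewrite -ln_div ?posrE//; last by lra.
    have -> : K / (K - 6) = 1 + 6 / (K - 6) by field; rewrite gt_eqF.
    by apply: le_ln1Dx; rewrite (lt_trans (@ltrN10 R))// divr_gt0.
  have lp : (ln K - ln (K - 6)) * pi <= 6 / (K - 6) * pi by rewrite ler_wpM2r// ltW.
  have -> : 6 * pi / (K - 6) = 6 / (K - 6) * pi by rewrite mulrAC.
  rewrite mulrBl in lp; rewrite /h.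
  move=> /andP[? ?] /andP[? ?]; rewrite ler_norml; apply/andP; split; lra.
apply/eqP; rewrite -subr_eq0 -/(h k) -normr_le0 leNgt; apply/negP => hk.
(* Then [K - 6] exceeds [6 pi / |h k|], so the bound on [|h K|] is smaller than [|h k| = |h K|]. *)
pose K := k + 6 + 6 * pi / `|h k|.
have q0 : 0 < 6 * pi / `|h k| by rewrite divr_gt0// mulr_gt0.
have kK : k <= K by rewrite /K; lra.
have K8 : 8 < K by lra.
have := hb K K8; rewrite -(hK K kK) leNgt => /negP; apply.
have K6 : 0 < K - 6 by lra.
rewrite ltr_pdivrMr// -ltr_pdivrMl// mulrC /K; lra.
Qed.

End LandenLog.

(** * Proof of the theorem *)

Section HalfPeriods.
Context {R : realType}.
Local Notation mu := (@lebesgue_measure R).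
Local Notation der f x d := (is_derive x (1 : R) f d).

Variable f : R -> R.
Hypothesis cf : continuous f.

(** By the symmetry, [F (2 pi - x) + F x] is constant; it is compared at [0] and [pi]. *)
Lemma integral_symmetric : (forall t, f (2 * pi - t) = f t) ->
  \int[mu]_(t in `[0, 2 * pi]) f t = 2 * \int[mu]_(t in `[0, pi]) f t.
Proof.
move=> sf; have p0 := @pi_gt0 R.
have [F dF] := primitive_exists (-1) cf.
have dFI (c d x : R) : 0 <= c -> c <= x <= d -> der F x (f x).
  by move=> c0 /andP[cx _]; apply: dF; lra.
have h0 : (0 : R) <= 0 by [].
have p2 : 0 <= 2 * pi :> R by lra.
rewrite (derive_integral_continuous p2 cf (fun x => @dFI 0 _ x h0)).
rewrite (derive_integral_continuous (ltW p0) cf (fun x => @dFI 0 _ x h0)).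
have H : F (-1 * 0 + 2 * pi) + F 0 = F (-1 * pi + 2 * pi) + F pi.
  apply: (@derive0_eq _ (fun x => F (-1 * x + 2 * pi) + F x) 0 pi (ltW p0)) => x /andP[x0 xp].
  have h1 : der F (-1 * x + 2 * pi) (f (-1 * x + 2 * pi)) by apply: dF; lra.
  have h2 : der F x (f x) by apply: dF; lra.
  have h3 := @der_comp _ F (fun x => -1 * x + 2 * pi) _ _ _ h1 (is_derive_affine (-1) (2 * pi) x).
  apply: (der_eq (derD h3 h2)).
  have -> : -1 * x + 2 * pi = 2 * pi - x by ring.
  by rewrite sf; ring.
move: H; rewrite mulr0 add0r.
have -> : -1 * pi + 2 * pi = pi :> R by ring.
by lra.
Qed.

(** Halving the angle maps the circle to [[0, pi]]; the period [pi] moves this to the symmetric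
    interval of the Landen substitution. *)
Lemma integral_half_angle : (forall t, f (t + pi) = f t) ->
  \int[mu]_(t in `[0, 2 * pi]) f (2^-1 * t) =
  2 * \int[mu]_(t in `[- (pi / 2), pi / 2]) f t.
Proof.
move=> pf; have p0 := @pi_gt0 R.
have [F dF] := primitive_exists (- (2 * pi)) cf.
have p2 : 0 <= 2 * pi :> R by lra.
have pp : - (pi / 2) <= pi / 2 :> R by lra.
have c2 : continuous (fun t : R => f (2^-1 * t)).
  move=> x; apply: (@continuous_comp _ _ _ (fun t : R => 2^-1 * t) f); last exact: cf.
  by apply: cvgM; [exact: cvg_cst|exact: cvg_id].
have d2 (x : R) : 0 <= x <= 2 * pi -> der (fun t => 2 * F (2^-1 * t)) x (f (2^-1 * x)).
  move=> /andP[x0 _].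
  have h1 : der F (2^-1 * x) (f (2^-1 * x)) by apply: dF; lra.
  have h2 := @der_comp _ F (fun x => 2^-1 * x) _ _ _ h1 (derZ 2^-1 (is_derive_id x 1)).
  by apply: (der_eq (derZ 2 h2)); field.
have d1 (x : R) : - (pi / 2) <= x <= pi / 2 -> der F x (f x).
  by move=> /andP[x0 _]; apply: dF; lra.
rewrite (derive_integral_continuous p2 c2 d2) (derive_integral_continuous pp cf d1).
have H : F (1 * - (pi / 2) + pi) - F (- (pi / 2)) = F (1 * 0 + pi) - F 0.
  have q0 : - (pi / 2) <= 0 :> R by lra.
  apply: (@derive0_eq _ (fun x => F (1 * x + pi) - F x) _ _ q0) => x /andP[x0 xp].
  have h1 : der F (1 * x + pi) (f (1 * x + pi)) by apply: dF; lra.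
  have h2 : der F x (f x) by apply: dF; lra.
  have h3 := @der_comp _ F (fun x => 1 * x + pi) _ _ _ h1 (is_derive_affine 1 pi x).
  by apply: (der_eq (derB h3 h2)); rewrite mul1r pf mulr1 subrr.
have e1 : 1 * - (pi / 2) + pi = pi / 2 :> R by field.
have e2 : 2^-1 * (2 * pi) = pi :> R by field.
move: H; rewrite e1 e2 !mulr0 add0r.
by lra.
Qed.

End HalfPeriods.

Section Main.
Context {R : realType}.

(** The symmetry of [P_log] and the period [pi] of [J_log] reduce both circles to the half ranges
    compared in [landen_log]. *)
Lemma circle_mean_J_log (k v : R) : 8 < k -> circle_mean (P_log k) v ->
  circle_mean (fun t => J_log k (2^-1 * t)) v.
Proof.
move=> k8 [_ Pv]; have cJ := continuous_J_log k8.
have c2 : continuous (fun t : R => J_log k (2^-1 * t)).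
  move=> x; apply: (@continuous_comp _ _ _ (fun t : R => 2^-1 * t) (J_log k)); last exact: cJ.
  by apply: cvgM; [exact: cvg_cst|exact: cvg_id].
split; first exact: continuous_integrable.
rewrite -Pv (integral_half_angle cJ); last first.
  by move=> t; rewrite /J_log /J_root cosDpi sqrrN.
rewrite -landen_log// (integral_symmetric (continuous_P_log k8))// => t.
by rewrite /P_log [2 * pi - t]addrC [2 * pi]mulr_natl cosD2pi cosN.
Qed.

Lemma J_log_half (k t : R) : J_log k (2^-1 * t) =
  let T := big_root (k - 4) (2 + 2 * cos t) in
  ln ((T + 2 + Num.sqrt (T ^+ 2 + 4 * T)) / 2).
Proof.
rewrite /J_log /J_root; have -> : 4 * cos (2^-1 * t) ^+ 2 = 2 + 2 * cos t => //.
have {2}-> : t = (2^-1 * t) *+ 2 by rewrite -mulr_natr; field.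
by rewrite cos_mulr2n; ring.
Qed.

(** With [r^2 = T^2 + 4 T] one has [((T + r) / 2)^2 = T (T + 2 + r) / 2]. This is the source of the
    factor one half and of the two separate Mahler measures. *)
Lemma ln_add_sqrt (T : R) : 0 < T ->
  ln ((T + Num.sqrt (T ^+ 2 + 4 * T)) / 2) =
  2^-1 * ln T + 2^-1 * ln ((T + 2 + Num.sqrt (T ^+ 2 + 4 * T)) / 2).
Proof.
move=> T0; have h : 0 < T ^+ 2 + 4 * T by nra.
have := sqr_sqrtr (ltW h); have : 0 < Num.sqrt (T ^+ 2 + 4 * T) by rewrite sqrtr_gt0.
move: (Num.sqrt _) => r r0 rr.
rewrite -mulrDr -lnM ?posrE//; last by lra.
have -> : T * ((T + 2 + r) / 2) = ((T + r) / 2) ^+ 2.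
  transitivity ((T ^+ 2 + 2 * T * r + (T ^+ 2 + 4 * T)) / 4); first by field.
  by rewrite -rr; field.
by rewrite lnXn; [rewrite -[_ *+ 2]mulr_natr; field|lra].
Qed.

Lemma mean_ln_big_root_exists (A : R) : 0 < A ->
  exists v, circle_mean (fun t => ln (big_root A (2 + 2 * cos t))) v.
Proof.
move=> A0; eexists; apply: circle_mean_continuous; apply: continuous_ln_fun.
  apply: continuous_big_root; first exact: continuous_cst_fun.
  apply: continuousD_fun; first exact: continuous_cst_fun.
  by apply: continuousM_fun; [exact: continuous_cst_fun|exact: continuous_cos].
by move=> t; apply: lt_le_trans (big_root_ge _ _); lra.
Qed.

End Main.

(* Composition \Po acts on the outer variable 'X, that is, on x. *)
Theorem theorem1p1 (R : realType) (k : R) :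
  (k <= -1 -> mahler (Q_ k \Po ('X - 1))%:F = mahler (R_ k)) /\
  (17 <= k ->
     mahler (Q_ k \Po ('X - 1))%:F
     = 2^-1 * (mahler (P_ k)%:F + mahler (R_ k))).
Proof.
split=> hk.
  have A0 : 0 < 4 - k by lra.
  have [v Rv] := mean_ln_big_root_exists A0.
  have kE : `|k - 4| = 4 - k by rewrite ler0_norm; lra.
  rewrite (@mahler_R _ k v) ?kE//; last by lra.
  apply: (mahler_Q_shift _ _ Rv); first by left; lra.
  by move=> t _; exact: Qscaled_mean_neg.
have A0 : 0 < k - 4 by lra.
have [v Rv] := mean_ln_big_root_exists A0.
have kE : `|k - 4| = k - 4 by rewrite ger0_norm; lra.
rewrite (@mahler_R _ k v) ?kE//; last by lra.
have k8 : 8 < k by lra.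
have Pw := circle_mean_continuous (continuous_P_log k8).
set w := _ * _ in Pw.
rewrite (mahler_P k8 Pw) mulrDr [RHS]addrC.
have Jw := circle_mean_J_log k8 Pw.
apply: (mahler_Q_shift (or_intror hk) (fun t _ => Qscaled_mean_pos t hk)).
have := circle_meanD (circle_meanZ 2^-1 Rv) (circle_meanZ 2^-1 Jw).
apply: circle_mean_eq => t _ /=; rewrite J_log_half /= ln_add_sqrt//.
by apply: lt_le_trans (big_root_ge _ _); lra.
Qed.
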